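(* Let $A$ be an $n$-Nakayama algebra with Kupisch series $[c_0,\dots,c_{n-1}]$ and coKupisch series $[d_0,\dots,d_{n-1}]$, and let $S_i$ be a simple $A$-module which is not projective. Then (1) $S_i$ is $1$-regular if and only if $c_i - c_{i+1} = d_{i+1} - d_i = 1$; (2) $S_i$ is $2$-regular if and only if $c_i = d_{i+2} = 2$ and $c_{i+1} - c_{i+2} = d_{i+1} - d_i = 1$.
   Context: Fix a field $\mathbb{F}$. For $n\ge 1$, an $n$-Nakayama algebra is an algebra $A=\mathbb{F}Q/I$, where $Q$ is either the linear quiver $0\to 1\to\cdots\to n-1$ or the cyclic quiver $0\to1\to\cdots\to n-1\to 0$, and $I$ is an admissible ideal ($J^m\subseteq I\subseteq J^2$ for some $m\ge 2$, $J$ the ideal generated by the arrows). In the linear case $A$ is an $n$-LNakayama algebra, in the cyclic case an $n$-CNakayama algebra. Modules are finite-dimensional right $A$-modules. Let $e_i$ be the idempotent at vertex $i$ and $S_i$ the simple module at vertex $i$. The Kupisch series is $[c_0,\dots,c_{n-1}]$ with $c_i=\dim_{\mathbb{F}} e_iA$, and the coKupisch series is $[d_0,\dots,d_{n-1}]$ with $d_i=\dim_{\mathbb{F}} Ae_i$. For CNakayama algebras, indices are read modulo $n$ ($c_{i+n}=c_i$, $d_{i+n}=d_i$, $S_{i+n}=S_i$). For $n$-LNakayama algebras $c_{n-1}=1$, $S_{n-1}$ is the only projective simple module, and we set $c_j=d_j=0$ for $j\ge n$. A simple $A$-module $S$ is $k$-regular ($k\in\mathbb{N}$) if $\operatorname{pd}(S)=k$,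 $\operatorname{Ext}^i_A(S,A)=0$ for $0\le i<k$, and $\dim_{\mathbb{F}}\operatorname{Ext}^k_A(S,A)=1$. *)

(* Defs.v *)
From HB Require Import structures.
From mathcomp Require Import all_boot all_order all_algebra all_field.
From mathcomp Require Import finmap.
From mathcomp.multinomials Require Import monalg.

Set Implicit Arguments.
Unset Strict Implicit.
Unset Printing Implicit Defensive.

Import GRing.Theory.
Local Open Scope ring_scope.

(** * Quivers and path algebras *)

Record quiver := Quiver {
  vertex : finType;
  arrow : finType;
  source : arrow -> vertex;
  target : arrow -> vertex
}.

Section Paths.
Variable Q : quiver.
Implicit Types (v : vertex Q) (s : seq (arrow Q)).

Fixpoint composable v s : bool :=
  if s is a :: s' then (source a == v) && composable (target a) s' else true.

Definition end_of v s : vertex Q := last v (map (@target Q) s).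

(* A path is its starting vertex together with its arrows in the order in
   which they are travelled; the empty sequence gives the trivial path. *)
Record qpath := QPath {
  qpath_val : vertex Q * seq (arrow Q);
  _ : composable qpath_val.1 qpath_val.2
}.

HB.instance Definition _ := [isSub for qpath_val].
HB.instance Definition _ := [Choice of qpath by <:].

Definition pstart (p : qpath) : vertex Q := (val p).1.
Definition parrows (p : qpath) : seq (arrow Q) := (val p).2.
Definition pend (p : qpath) : vertex Q := end_of (pstart p) (parrows p).

Definition trivial_path v : qpath := @QPath (v, [::]) isT.

Lemma arrow_path_subproof (a : arrow Q) :
  composable (source a, [:: a]).1 (source a, [:: a]).2.
Proof. by rewrite /= eqxx. Qed.

Definition arrow_path (a : arrow Q) : qpath := QPath (arrow_path_subproof a).

Lemma composable_cat v s t :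
  composable v (s ++ t) = composable v s && composable (end_of v s) t.
Proof. by elim: s v => //= a s IHs v; rewrite IHs andbA. Qed.

Lemma end_of_cat v s t : end_of v (s ++ t) = end_of (end_of v s) t.
Proof. by rewrite /end_of map_cat last_cat. Qed.

(* [path_comp p q] is "p followed by q". *)
Definition path_comp (p q : qpath) : option qpath :=
  if pend p == pstart q then insub (pstart p, parrows p ++ parrows q) else None.

Lemma path_compP p q : pend p = pstart q ->
  exists2 r, path_comp p q = Some r &
    val r = (pstart p, parrows p ++ parrows q).
Proof.
move=> epq; rewrite /path_comp epq eqxx.
case: insubP => [r _ er|]; first by exists r.
by rewrite /= composable_cat (valP p) /= -/(pend p) epq (valP q).
Qed.

Lemma path_comp0 p q : pend p != pstart q -> path_comp p q = None.
Proof. by rewrite /path_comp => /negPf->. Qed.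

Lemma path_compA p q r :
  obind (path_comp p) (path_comp q r) = obind (path_comp^~ r) (path_comp p q).
Proof.
case: (eqVneq (pend p) (pstart q)) => epq; last first.
  rewrite (path_comp0 epq) /=.
  case: (eqVneq (pend q) (pstart r)) => eqr; last by rewrite (path_comp0 eqr).
  have [u -> eu] := path_compP eqr.
  by rewrite /= path_comp0 // /pstart eu.
have [t et vt] := path_compP epq; rewrite et /=.
have et' : pend t = pend q.
  by rewrite /pend {1}/pstart {1}/parrows vt /= end_of_cat -/(pend p) epq.
case: (eqVneq (pend q) (pstart r)) => eqr; last first.
  by rewrite (path_comp0 eqr) /= path_comp0 // et'.
have [u eu vu] := path_compP eqr; rewrite eu /=.
have epu : pend p = pstart u by rewrite epq /pstart vu.
have etr : pend t = pstart r by rewrite et'.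
have [w -> vw] := path_compP epu; have [w' -> vw'] := path_compP etr.
congr Some; apply: val_inj; rewrite vw vw'.
have -> : pstart t = pstart p by rewrite /pstart vt.
have -> : parrows t = parrows p ++ parrows q by rewrite {1}/parrows vt.
have -> : parrows u = parrows q ++ parrows r by rewrite {1}/parrows vu.
by rewrite catA.
Qed.

Lemma path_comp1 v p :
  path_comp (trivial_path v) p = if v == pstart p then Some p else None.
Proof.
case: eqP => [evp|/eqP evp]; last exact: path_comp0.
have [r -> vr] := @path_compP (trivial_path v) p evp; congr Some.
by apply: val_inj; rewrite vr [RHS]surjective_pairing /=; congr (_, _).
Qed.

Lemma path_comp1r v p :
  path_comp p (trivial_path v) = if v == pend p then Some p else None.
Proof.
rewrite eq_sym; case: eqP => [evp|/eqP evp]; last exact: path_comp0.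
have [r -> vr] := @path_compP p (trivial_path v) evp; congr Some.
by apply: val_inj; rewrite vr [RHS]surjective_pairing cats0.
Qed.

End Paths.

Definition pathalg (F : fieldType) (Q : quiver) := {malg F[qpath Q]}.

HB.instance Definition _ (F : fieldType) (Q : quiver) :=
  GRing.Lmodule.on (pathalg F Q).

(* The basis element of FQ given by a path. Locked, so that unification does
   not look into the representation of finitely supported functions. *)
HB.lock Definition path_elt (F : fieldType) (Q : quiver) (p : qpath Q) :
  pathalg F Q := << (1 : F) *g p >>.

Section PathMul.
Variables (F : fieldType) (Q : quiver).
Local Notation FQ := (pathalg F Q).
Local Notation path_elt := (@path_elt F Q).

Definition path_extend (f : qpath Q -> FQ) (x : FQ) : FQ :=
  \sum_(p <- msupp x) x@_p *: f p.

Definition path_mul_elt (p q : qpath Q) : FQ :=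
  if path_comp p q is Some r then path_elt r else 0.

End PathMul.

(* The bilinear extension of path_mul_elt. *)
HB.lock Definition pathalg_mul (F : fieldType) (Q : quiver)
    (x y : pathalg F Q) : pathalg F Q :=
  path_extend (fun p => path_extend (path_mul_elt F p) y) x.

Section PathAlgebra.
Variables (F : fieldType) (Q : quiver).
Local Notation FQ := (pathalg F Q).
Local Notation path_elt := (@path_elt F Q).
Local Notation path_extend := (@path_extend F Q).
Local Notation pathalg_mul := (@pathalg_mul F Q).

Definition pathalg_one : FQ := \sum_(v : vertex Q) path_elt (trivial_path v).

Lemma path_extendw f (x : FQ) (d : {fset qpath Q}) : (msupp x `<=` d)%fset ->
  path_extend f x = \sum_(p <- d) x@_p *: f p.
Proof.
move=> le; rewrite /path_extend (big_fset_incl _ le) // => p _ /mcoeff_outdom ->.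
by rewrite scale0r.
Qed.

Lemma path_extend_is_linear f : linear (path_extend f).
Proof.
move=> c x y; pose d := (msupp x `|` msupp y `|` msupp (c *: x + y))%fset.
rewrite !(@path_extendw _ _ d) ?fsubsetUr //; last first.
- by rewrite /d -fsetUA fsubsetUl.
- by rewrite /d fsetUAC fsubsetUr.
rewrite scaler_sumr -big_split /=; apply: eq_bigr => p _.
by rewrite mcoeffD mcoeffZ scalerDl scalerA.
Qed.

HB.instance Definition _ f := GRing.isLinear.Build F FQ FQ _ (path_extend f)
  (path_extend_is_linear f).

Lemma path_extendU f p : path_extend f (path_elt p) = f p.
Proof.
rewrite path_elt.unlock (path_extendw _ (msuppU_le)) big_seq_fset1.
by rewrite mcoeffUU scale1r.
Qed.

Lemma path_eltE (x : FQ) : x = \sum_(p <- msupp x) x@_p *: path_elt p.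
Proof.
rewrite {1}[x]monalgE; apply: eq_bigr => p _.
by apply/malgP => q; rewrite path_elt.unlock mcoeffZ !mcoeffU mulr_natr.
Qed.

Lemma eq_path_extend f g : f =1 g -> path_extend f =1 path_extend g.
Proof. by move=> fg x; apply: eq_bigr => p _; rewrite fg. Qed.

Lemma path_extend_lin (h : {linear FQ -> FQ}) f x :
  h (path_extend f x) = path_extend (h \o f) x.
Proof.
by rewrite linear_sum; apply: eq_bigr => p _; rewrite linearZ.
Qed.

Lemma path_extend_id x : path_extend path_elt x = x.
Proof. by rewrite [RHS]path_eltE. Qed.

Lemma path_extendD f g x :
  path_extend (fun p => f p + g p) x = path_extend f x + path_extend g x.
Proof. by rewrite -big_split; apply: eq_bigr => p _; rewrite scalerDr. Qed.

Lemma path_extendZ c f x :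
  path_extend (fun p => c *: f p) x = c *: path_extend f x.
Proof.
rewrite scaler_sumr; apply: eq_bigr => p _.
by rewrite !scalerA mulrC.
Qed.

Lemma pathalg_mulDl : left_distributive pathalg_mul +%R.
Proof. by move=> x y z; rewrite pathalg_mul.unlock linearD. Qed.

Lemma pathalg_mulDr : right_distributive pathalg_mul +%R.
Proof.
move=> x y z; rewrite pathalg_mul.unlock -path_extendD.
by apply: eq_path_extend => p; rewrite linearD.
Qed.

Lemma pathalg_scaleAl c x y : c *: pathalg_mul x y = pathalg_mul (c *: x) y.
Proof. by rewrite pathalg_mul.unlock linearZ. Qed.

Lemma pathalg_scaleAr c x y : c *: pathalg_mul x y = pathalg_mul x (c *: y).
Proof.
rewrite pathalg_mul.unlock -path_extendZ.
by apply: eq_path_extend => p; rewrite linearZ.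
Qed.

Lemma pathalg_mulr_is_linear x : linear (pathalg_mul x).
Proof. by move=> c y z; rewrite pathalg_mulDr pathalg_scaleAr. Qed.

HB.instance Definition _ x := GRing.isLinear.Build F FQ FQ _ (pathalg_mul x)
  (pathalg_mulr_is_linear x).

Definition pathalg_mulr_by (y x : FQ) : FQ := pathalg_mul x y.

Lemma pathalg_mull_is_linear y : linear (pathalg_mulr_by y).
Proof.
by move=> c x z; rewrite /pathalg_mulr_by pathalg_mulDl pathalg_scaleAl.
Qed.

HB.instance Definition _ y := GRing.isLinear.Build F FQ FQ _ (pathalg_mulr_by y)
  (pathalg_mull_is_linear y).

Lemma pathalg_mul0l x : pathalg_mul 0 x = 0.
Proof. exact: (linear0 (pathalg_mulr_by x)). Qed.

Lemma pathalg_mul0r x : pathalg_mul x 0 = 0.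
Proof. exact: (linear0 (pathalg_mul x)). Qed.

Lemma pathalg_mul1l x :
  pathalg_mul pathalg_one x =
  \sum_(v : vertex Q) pathalg_mul (path_elt (trivial_path v)) x.
Proof. exact: (linear_sum (pathalg_mulr_by x)). Qed.

Lemma pathalg_mul1r x :
  pathalg_mul x pathalg_one =
  \sum_(v : vertex Q) pathalg_mul x (path_elt (trivial_path v)).
Proof. exact: (linear_sum (pathalg_mul x)). Qed.

Lemma pathalg_mulUU p q :
  pathalg_mul (path_elt p) (path_elt q) = path_mul_elt F p q.
Proof. by rewrite pathalg_mul.unlock !path_extendU. Qed.

Lemma linear_path_ext (g h : {linear FQ -> FQ}) :
  (forall p, g (path_elt p) = h (path_elt p)) -> g =1 h.
Proof.
move=> gh x; rewrite [x]path_eltE !linear_sum; apply: eq_bigr => p _.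
by rewrite !linearZ gh.
Qed.

Lemma pathalg_mulUA p q r :
  pathalg_mul (path_elt p) (path_mul_elt F q r) =
  pathalg_mul (path_mul_elt F p q) (path_elt r).
Proof.
have := path_compA p q r; rewrite /path_mul_elt.
case: (path_comp q r) => [u|]; case: (path_comp p q) => [v|] /= E.
- by rewrite (pathalg_mulUU p u) (pathalg_mulUU v r) /path_mul_elt E.
- by rewrite (pathalg_mulUU p u) pathalg_mul0l /path_mul_elt E.
- by rewrite (pathalg_mulUU v r) pathalg_mul0r /path_mul_elt -E.
- by rewrite pathalg_mul0l pathalg_mul0r.
Qed.

Lemma pathalg_mulA : associative pathalg_mul.
Proof.
move=> x y z.
apply: (@linear_path_ext (pathalg_mulr_by (pathalg_mul y z))
  (pathalg_mulr_by z \o pathalg_mulr_by y)) => p.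
apply: (@linear_path_ext (pathalg_mul (path_elt p) \o pathalg_mulr_by z)
  (pathalg_mulr_by z \o pathalg_mul (path_elt p))) => q.
apply: (@linear_path_ext (pathalg_mul (path_elt p) \o pathalg_mul (path_elt q))
  (pathalg_mul (pathalg_mul (path_elt p) (path_elt q)))) => r.
rewrite (pathalg_mulUU p q); have /= -> := pathalg_mulUU q r.
exact: pathalg_mulUA.
Qed.

Lemma pathalg_mul1 : left_id pathalg_one pathalg_mul.
Proof.
apply: (@linear_path_ext (pathalg_mul pathalg_one) idfun) => p.
rewrite /= pathalg_mul1l (bigD1 (pstart p)) //= big1.
  by rewrite (pathalg_mulUU _ p) /path_mul_elt path_comp1 eqxx addr0.
by move=> v /negPf nv; rewrite (pathalg_mulUU _ p) /path_mul_elt path_comp1 nv.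
Qed.

Lemma pathalg_mulr1 : right_id pathalg_one pathalg_mul.
Proof.
apply: (@linear_path_ext (pathalg_mulr_by pathalg_one) idfun) => p.
rewrite /= /pathalg_mulr_by pathalg_mul1r (bigD1 (pend p)) //= big1.
  by rewrite (pathalg_mulUU p) /path_mul_elt path_comp1r eqxx addr0.
by move=> v /negPf nv; rewrite (pathalg_mulUU p) /path_mul_elt path_comp1r nv.
Qed.

(* The quiver may have no vertex, so FQ is only a possibly zero ring; this is
   why it is not declared as an algType. *)
HB.instance Definition _ := GRing.Zmodule_isPzRing.Build FQ
  pathalg_mulA pathalg_mul1 pathalg_mulr1 pathalg_mulDl pathalg_mulDr.

End PathAlgebra.

(** * Two-sided ideals, as predicates *)

Section Ideals.
Variable R : pzRingType.
Implicit Types (I J X : R -> Prop).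

Definition two_sided_ideal I : Prop :=
  [/\ I 0, forall x y, I x -> I y -> I (x + y)
    & forall a x b, I x -> I (a * x * b)].

Definition ideal_gen X : R -> Prop := fun x =>
  forall I, two_sided_ideal I -> (forall y, X y -> I y) -> I x.

Definition ideal_mul I J : R -> Prop :=
  ideal_gen (fun z => exists x y, [/\ I x, J y & z = x * y]).

Definition ideal_exp I (m : nat) : R -> Prop :=
  iter m (ideal_mul I) (fun=> True).

End Ideals.

Definition arrow_ideal (F : fieldType) (Q : quiver) : pathalg F Q -> Prop :=
  ideal_gen (fun x => exists a : arrow Q, x = path_elt F (arrow_path a)).

Definition admissible (F : fieldType) (Q : quiver) (I : pathalg F Q -> Prop) :=
  two_sided_ideal I /\
  exists2 m : nat, (2 <= m)%N &
    (forall x, ideal_exp (@arrow_ideal F Q) m x -> I x) /\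
    (forall x, I x -> ideal_exp (@arrow_ideal F Q) 2 x).

(* "A = FQ/I": pi is a surjective morphism of F-algebras with kernel I. *)
Definition is_quotient_map (F : fieldType) (Q : quiver) (A : falgType F)
    (I : pathalg F Q -> Prop) (pi : {rmorphism pathalg F Q -> A}) : Prop :=
  [/\ scalable pi, forall a : A, exists x, pi x = a
    & forall x, pi x = 0 <-> I x].

(** * Nakayama algebras *)

Inductive nakayama_type := Linear | Cyclic.

Definition is_cyclic (t : nakayama_type) : bool :=
  if t is Cyclic then true else false.

(* There is one arrow i -> i+1 for each i in the subtype of arrows. In the
   linear case i.+1 < n, hence ordS (which is i.+1 %% n) is a plain successor. *)
Definition nakayama_quiver (t : nakayama_type) (n : nat) : quiver :=
  @Quiver 'I_n {i : 'I_n | is_cyclic t || (i.+1 < n)%N}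
    (fun a => val a) (fun a => ordS (val a)).

Section Nakayama.
Variables (F : fieldType) (t : nakayama_type) (n : nat) (A : falgType F).
Variable pi : pathalg F (nakayama_quiver t n) -> A.

Definition idemp (i : 'I_n) : A :=
  pi (path_elt F (@trivial_path (nakayama_quiver t n) i)).

(* The vertex with index j : nat: indices are read modulo n in the cyclic case,
   and there is no such vertex when n <= j in the linear case. *)
Definition vertex_at (j : nat) : option 'I_n :=
  insub (if is_cyclic t then (j %% n)%N else j).

Definition kupisch (j : nat) : nat :=
  if vertex_at j is Some v then \dim (<[idemp v]> * {:A})%VS else 0%N.

Definition cokupisch (j : nat) : nat :=
  if vertex_at j is Some v then \dim ({:A} * <[idemp v]>)%VS else 0%N.

End Nakayama.

(** * Finite-dimensional right modules *)

Record rmodule (F : fieldType) (A : falgType F) := RModule {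
  rmod_sort :> vectType F;
  ract : rmod_sort -> A -> rmod_sort;
  ract_linearl : forall a, linear (ract^~ a);
  ract_linearr : forall x, linear (ract x);
  ract1 : forall x, ract x 1 = x;
  ractM : forall x a b, ract x (a * b) = ract (ract x a) b
}.

Section RModules.
Variables (F : fieldType) (A : falgType F).
Implicit Types M N P : rmodule A.

Lemma regular_linearl (a : A) : linear (fun x : A => x * a).
Proof. by move=> c x y; rewrite mulrDl scalerAl. Qed.

Lemma regular_linearr (x : A) : linear (fun a : A => x * a).
Proof. by move=> c a b; rewrite mulrDr scalerAr. Qed.

Definition regular_rmodule : rmodule A :=
  @RModule F A A (fun x a => x * a) regular_linearl regular_linearr
    (@mulr1 A) (@mulrA A).

Definition is_rhom M N (f : 'Hom(M, N)) : Prop :=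
  forall x a, f (ract x a) = ract (f x) a.

Definition is_projective P : Prop :=
  forall M N (g : 'Hom(M, N)) (f : 'Hom(P, N)),
    is_rhom g -> is_rhom f -> limg g = fullv ->
    exists2 h : 'Hom(P, M), is_rhom h & (g \o h)%VF = f.

(* Hom_A(M, N) as a subspace of Hom_F(M, N); see mem_rhom. *)
Definition rhom_defect M N (a : A) (f : 'Hom(M, N)) : 'Hom(M, N) :=
  ((f \o linfun (@ract _ _ M ^~ a))
    - (linfun (@ract _ _ N ^~ a) \o f))%VF.

Definition rhom M N : {vspace 'Hom(M, N)} :=
  (\bigcap_(a <- vbasis {:A}) lker (linfun (@rhom_defect M N a)))%VS.

(* Hom_A(d, N) : f |-> f \o d, on all F-linear maps. *)
Definition precomp M N P (d : 'Hom(M, N)) : 'Hom('Hom(N, P), 'Hom(M, P)) :=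
  linfun (fun f : 'Hom(N, P) => (f \o d)%VF).

Lemma precompE M N P (d : 'Hom(M, N)) (f : 'Hom(N, P)) :
  precomp P d f = (f \o d)%VF.
Proof.
rewrite /precomp; set h := fun _ => _.
have hL : linear h by move=> c u v; rewrite /h comp_lfunDl comp_lfunZl.
pose hh := GRing.isLinear.Build F _ _ _ h hL.
pose H : {linear 'Hom(N, P) -> 'Hom(M, P)} := HB.pack h hh.
exact: (lfunE H f).
Qed.

Lemma ractE M (a : A) x : linfun (@ract _ _ M ^~ a) x = ract x a.
Proof.
pose hh := GRing.isLinear.Build F M M _ _ (@ract_linearl _ _ M a).
pose H : {linear M -> M} := HB.pack (@ract _ _ M ^~ a) hh.
exact: (lfunE H x).
Qed.

Lemma rhom_defectE M N (a : A) (f : 'Hom(M, N)) :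
  linfun (@rhom_defect M N a) f = rhom_defect a f.
Proof.
have hL : linear (@rhom_defect M N a).
  move=> c u v; rewrite /rhom_defect comp_lfunDl comp_lfunDr.
  by rewrite -comp_lfunZl -comp_lfunZr scalerBr opprD addrACA.
pose hh := GRing.isLinear.Build F _ _ _ _ hL.
pose H : {linear 'Hom(M, N) -> 'Hom(M, N)} := HB.pack (@rhom_defect M N a) hh.
exact: (lfunE H f).
Qed.

Lemma mem_rhom M N (f : 'Hom(M, N)) : f \in rhom M N <-> is_rhom f.
Proof.
have defect0 a : rhom_defect a f = 0 <-> forall x, f (ract x a) = ract (f x) a.
  split=> [E x|E].
    have /lfunP/(_ x) := E; rewrite /rhom_defect add_lfunE opp_lfunE.
    by rewrite !comp_lfunE !ractE zero_lfunE => /eqP; rewrite subr_eq0 => /eqP.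
  apply/lfunP => x; rewrite /rhom_defect add_lfunE opp_lfunE.
  by rewrite !comp_lfunE !ractE zero_lfunE E subrr.
have inE : f \in rhom M N <->
    forall a, a \in tval (vbasis {:A}) -> rhom_defect a f = 0.
  rewrite /rhom; elim: (tval (vbasis {:A})) => [|b s IHs].
    by rewrite big_nil memvf; split=> // _ a; rewrite in_nil.
  rewrite big_cons memv_cap memv_ker rhom_defectE; split.
    case/andP => /eqP Eb /IHs Es a; rewrite in_cons => /predU1P[->|] //.
    exact: Es.
  move=> E; rewrite E ?mem_head // eqxx; apply/IHs => a sa.
  by apply: E; rewrite in_cons sa orbT.
split=> [/inE E x a|E]; last by apply/inE => a _; apply/defect0 => x; apply: E.
have linr (L : rmodule A) (y : L) : linear (@ract _ _ L y).
  exact: ract_linearr.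
have lin_sum (L : rmodule A) (y : L) (k : nat) (c : 'I_k -> F) (b : 'I_k -> A) :
    ract y (\sum_i c i *: b i) = \sum_i c i *: ract y (b i).
  pose hh := GRing.isLinear.Build F A L _ _ (linr L y).
  pose H : {linear A -> L} := HB.pack (@ract _ _ L y) hh.
  rewrite -[LHS]/(H _) linear_sum; apply: eq_bigr => i _.
  by rewrite linearZ.
rewrite (coord_vbasis (memvf a)) !lin_sum linear_sum; apply: eq_bigr => i _.
rewrite linearZ /=; congr (_ *: _).
apply: (proj1 (defect0 _)); apply: E.
by rewrite mem_nth ?size_tuple.
Qed.

Record proj_resolution M := ProjResolution {
  res_obj : nat -> rmodule A;
  res_aug : 'Hom(res_obj 0, M);
  res_diff : forall k, 'Hom(res_obj k.+1, res_obj k);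
  res_proj : forall k, is_projective (res_obj k);
  res_aug_hom : is_rhom res_aug;
  res_diff_hom : forall k, is_rhom (res_diff k);
  res_aug_surj : limg res_aug = fullv;
  res_exact0 : lker res_aug = limg (res_diff 0);
  res_exact : forall k, lker (res_diff k) = limg (res_diff k.+1)
}.

Section Cohomology.
Variables (M : rmodule A) (R : proj_resolution M) (N : rmodule A).

Definition cocycles (k : nat) : {vspace 'Hom(res_obj R k, N)} :=
  (rhom (res_obj R k) N :&: lker (precomp N (res_diff R k)))%VS.

Definition coboundaries (k : nat) : {vspace 'Hom(res_obj R k, N)} :=
  match k with
  | 0 => 0%VS
  | k'.+1 => (precomp N (res_diff R k') @: rhom (res_obj R k') N)%VS
  end.

Lemma coboundaries_sub k : (coboundaries k <= cocycles k)%VS.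
Proof.
case: k => [|k]; first exact: sub0v.
apply/subvP => _ /memv_imgP[f /mem_rhom fA ->].
rewrite memv_cap memv_ker !precompE; apply/andP; split.
  by apply/mem_rhom => x a; rewrite !comp_lfunE (@res_diff_hom _ R) fA.
apply/eqP/lfunP => x; rewrite !comp_lfunE zero_lfunE.
suff -> : res_diff R k (res_diff R k.+1 x) = 0 by rewrite linear0.
by apply/eqP; rewrite -memv_ker res_exact memv_img ?memvf.
Qed.

End Cohomology.

(* dim_F Ext^k_A(M, N) = d, where Ext^k_A(M, N) is the k-th cohomology (cocycles
   modulo coboundaries) of Hom_A(P, N) for a projective resolution P of M. *)
Definition ext_dim M N (k d : nat) : Prop :=
  exists R : proj_resolution M,
    (\dim (cocycles R N k) - \dim (coboundaries R N k))%N = d.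

Definition pd_le M (k : nat) : Prop :=
  exists R : proj_resolution M,
    forall j, (k < j)%N -> \dim {: res_obj R j} = 0%N.

Definition pd_eq M (k : nat) : Prop :=
  pd_le M k /\ forall j, (j < k)%N -> ~ pd_le M j.

Definition regular (k : nat) (S : rmodule A) : Prop :=
  [/\ pd_eq S k,
      forall i, (i < k)%N -> ext_dim S regular_rmodule i 0
    & ext_dim S regular_rmodule k 1].

End RModules.

(* S is (isomorphic to) S_i, the representation with F at the vertex i, zero at
   the other vertices, and all arrows acting by zero. *)
Definition is_simple_at (F : fieldType) (t : nakayama_type) (n : nat)
    (A : falgType F) (pi : pathalg F (nakayama_quiver t n) -> A)
    (i : 'I_n) (S : rmodule A) : Prop :=
  [/\ \dim {:S} = 1%N,
      forall (j : 'I_n) (x : S), ract x (idemp pi j) = if j == i then x else 0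
    & forall (a : arrow (nakayama_quiver t n)) (x : S),
        ract x (pi (path_elt F (arrow_path a))) = 0].

(* Main.v *)
(** All invariants are read off the minimal projective resolution of S_i, whose
    terms are right ideals e_v A and whose differentials are left multiplications
    by paths p_0, p_1, ...: p_0 is the arrow a_i leaving i, and p_{k+1} is the
    shortest path from the end of p_k with p_k p_{k+1} = 0. Nilpotency of the
    radical gives pd S_i <= k iff p_k = 0. Since Hom(e_v A, A) = A e_v, the space
    Ext^k(S_i, A) is the kernel of right multiplication by p_k on A e_v, modulo
    A p_{k-1}. As a_v A has codimension 1 in e_v A, and A a_v codimension 1 in
    A e_{v+1}, rank-nullity turns regularity into equations between the c's and
    the d's; for 2-regularity dim Ext^2 = 1 forces p_1 to be a single arrow. *)
Require Import Defs.
From HB Require Import structures.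
From mathcomp Require Import all_boot all_order all_algebra all_field.
From mathcomp Require Import zify.

Set Implicit Arguments.
Unset Strict Implicit.
Unset Printing Implicit Defensive.

Import GRing.Theory.
Local Open Scope ring_scope.

(** * Comparison of projective resolutions *)

(** Used to build chain maps and homotopies degree by degree. Since [P] and [r] are boolean on
    choice types, [xchoose] can pick each next term; the subtype carries the invariant [P] that lets
    the recursion continue. *)
Lemma dependent_choice (T : nat -> choiceType) (P : forall k, pred (T k))
    (r : forall k, T k -> T k.+1 -> bool) (x0 : T 0%N) :
  P 0%N x0 -> (forall k x, P k x -> exists y, P k.+1 y && r k x y) ->
  exists f : forall k, T k,
    f 0%N = x0 /\ forall k, P k (f k) /\ r k (f k) (f k.+1).
Proof.
move=> Px0 exS.
have PS k (x : {x | P k x}) : P k.+1 (xchoose (exS k _ (svalP x))).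
  by have /andP[] := xchooseP (exS k _ (svalP x)).
pose f := fix f k : {x | P k x} :=
  if k is k'.+1 then exist (P k'.+1) _ (PS k' (f k')) else exist (P 0%N) x0 Px0.
exists (fun k => sval (f k)); split=> // k; split; first exact: (svalP (f k)).
by have /andP[] := xchooseP (exS k _ (svalP (f k))).
Qed.

Lemma linfunE (F : fieldType) (V W : vectType F) (f : V -> W) :
  linear f -> linfun f =1 f.
Proof.
move=> fL x; pose h := GRing.isLinear.Build F V W _ f fL.
pose H : {linear V -> W} := HB.pack f h.
exact: (lfunE H x).
Qed.

Lemma sub_lfunE (F : fieldType) (V W : vectType F) (f g : 'Hom(V, W)) x :
  (f - g) x = f x - g x.
Proof. by rewrite add_lfunE opp_lfunE. Qed.

Lemma dim_line_add (F : fieldType) (V : vectType F) (x : V) (U : {vspace V}) :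
  x \notin U -> \dim (<[x]> + U) = (\dim U).+1.
Proof.
move=> xU; have xn0 : x != 0 by apply: contraNneq xU => ->; rewrite mem0v.
have xU0 : (<[x]> :&: U = 0)%VS.
  apply/eqP; rewrite -subv0; apply/subvP => y; rewrite memv_cap memv0.
  case/andP=> /vlineP[c ->]; have [->|cn0] := eqVneq c 0; rewrite ?scale0r //.
  by move=> /(memvZ c^-1); rewrite scalerA mulVf // scale1r (negPf xU).
by rewrite dimv_disjoint_sum // dim_vline xn0.
Qed.

(** * Submodules, and lifting from projective modules *)

Section Submodules.
Variables (F : fieldType) (A : falgType F).
Implicit Types M N P X Y : rmodule A.

Lemma ract0r M (x : M) : ract x 0 = 0.
Proof.
by have := ract_linearr x (-1) 0 0; rewrite scaler0 add0r scaleN1r addNr.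
Qed.

Lemma ract0l M (a : A) : ract (0 : M) a = 0.
Proof.
have := ract_linearl (r := M) a (-1) 0 0.
by rewrite /= scaler0 add0r scaleN1r addNr.
Qed.

Section Def.
Variables (M : rmodule A) (U : {vspace M}).
Hypothesis U_stable : forall x a, x \in U -> ract x a \in U.

Definition subract (x : subvs_of U) (a : A) : subvs_of U :=
  vsproj U (ract (vsval x) a).

Lemma subractE x a : vsval (subract x a) = ract (vsval x) a.
Proof. by rewrite vsprojK // U_stable ?subvsP. Qed.

Fact subract_linearl a : linear (subract^~ a).
Proof.
move=> c x y; apply: subvs_inj; rewrite /= subractE linearP ract_linearl.
by rewrite ?linearP !subractE.
Qed.

Fact subract_linearr x : linear (subract x).
Proof.
move=> c a b; apply: subvs_inj; rewrite /= subractE ract_linearr.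
by rewrite ?linearP !subractE.
Qed.

Fact subract1 x : subract x 1 = x.
Proof. by apply: subvs_inj; rewrite /= subractE ract1. Qed.

Fact subractM x a b : subract x (a * b) = subract (subract x a) b.
Proof.
by apply: subvs_inj; rewrite /= subractE [RHS]subractE subractE ractM.
Qed.

Definition sub_rmodule : rmodule A :=
  RModule subract_linearl subract_linearr subract1 subractM.

End Def.

Lemma comp_rhom M N P (g : 'Hom(N, P)) (f : 'Hom(M, N)) :
  is_rhom g -> is_rhom f -> is_rhom (g \o f)%VF.
Proof. by move=> gA fA x a; rewrite !comp_lfunE fA gA. Qed.

Lemma sub_rhom M N (f g : 'Hom(M, N)) :
  is_rhom f -> is_rhom g -> is_rhom (f - g).
Proof. by move=> /mem_rhom fA /mem_rhom gA; apply/mem_rhom/rpredB. Qed.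

Lemma id_rhom M : is_rhom (\1%VF : 'Hom(M, M)).
Proof. by move=> x a; rewrite !id_lfunE. Qed.

(** Projectivity speaks of surjections only, so the codomain is first cut down to the submodule
    [limg d], on which [d] becomes onto. *)
Lemma proj_lift P X Y (d : 'Hom(X, Y)) (f : 'Hom(P, Y)) :
  is_projective P -> is_rhom d -> is_rhom f -> (limg f <= limg d)%VS ->
  exists2 h : 'Hom(P, X), is_rhom h & (d \o h)%VF = f.
Proof.
move=> prP dA fA fd.
have st (y : Y) a : y \in limg d -> ract y a \in limg d.
  by case/memv_imgP => x _ ->; rewrite -dA memv_img ?memvf.
pose N := sub_rmodule st.
pose pr (Z : rmodule A) (q : 'Hom(Z, Y)) : 'Hom(Z, N) :=
  linfun (vsproj (limg d) \o q).
have prE (Z : rmodule A) (q : 'Hom(Z, Y)) z :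
    (limg q <= limg d)%VS -> vsval (pr Z q z) = q z.
  by move=> /subvP qd; rewrite lfunE /= vsprojK // qd // memv_img ?memvf.
have prA (Z : rmodule A) (q : 'Hom(Z, Y)) : (limg q <= limg d)%VS ->
    is_rhom q -> is_rhom (pr Z q : 'Hom(Z, N)).
  move=> qd qA z a; apply: subvs_inj.
  by rewrite /= prE // qA [RHS](subractE st) prE.
have [|||h hA hE] := @prP X N (pr X d) (pr P f).
- exact: prA.
- exact: prA.
- apply/eqP; rewrite eqEsubv subvf /=; apply/subvP => y _.
  have /memv_imgP[x _ xE] := subvsP y.
  apply/memv_imgP; exists x; first exact: memvf.
  by apply: subvs_inj; rewrite /= prE.
exists h => //; apply/lfunP => z; rewrite comp_lfunE -prE // -[RHS]prE //.
by rewrite -hE comp_lfunE.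
Qed.

End Submodules.

(** * Chain maps and homotopies between two resolutions *)

Section Comparison.
Variables (F : fieldType) (A : falgType F) (M : rmodule A).
Implicit Types (R : proj_resolution M) (N : rmodule A).

Lemma res_aug_diff R x : res_aug R (res_diff R 0 x) = 0.
Proof. by apply/eqP; rewrite -memv_ker res_exact0 memv_img ?memvf. Qed.

Lemma res_diff_diff R k x : res_diff R k (res_diff R k.+1 x) = 0.
Proof. by apply/eqP; rewrite -memv_ker res_exact memv_img ?memvf. Qed.

Definition chain_map R R' (f : forall k, 'Hom(res_obj R k, res_obj R' k)) :=
  [/\ forall k, is_rhom (f k),
      forall x, res_aug R' (f 0%N x) = res_aug R x
    & forall k x, res_diff R' k (f k.+1 x) = f k (res_diff R k x)].

Lemma chain_map_exists R R' : exists f, @chain_map R R' f.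
Proof.
have [|f0 f0A f0E] := proj_lift (@res_proj _ _ _ R 0%N) (@res_aug_hom _ _ _ R')
  (@res_aug_hom _ _ _ R); first by rewrite (res_aug_surj R') subvf.
(* The invariant says that [f] carries boundaries of [R] to boundaries of [R']; this is what allows
   [f] composed with the differential to be lifted to the next degree. *)
pose P k (f : 'Hom(res_obj R k, res_obj R' k)) := (f \in rhom _ _) &&
  (limg (f \o res_diff R k)%VF <= limg (res_diff R' k))%VS.
have [||f [fE fP]] := @dependent_choice _ P
  (fun k f g => (res_diff R' k \o g == f \o res_diff R k)%VF) f0.
- apply/andP; split; first exact/mem_rhom.
  rewrite -res_exact0; apply/subvP => _ /memv_imgP[x _ ->].
  by rewrite memv_ker comp_lfunE -(comp_lfunE _ f0) f0E res_aug_diff.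
- move=> k f /andP[/mem_rhom fA fd].
  have [||g gA gE] := proj_lift (@res_proj _ _ _ R k.+1) _ _ fd.
  + exact: res_diff_hom.
  + by apply: comp_rhom => //; exact: res_diff_hom.
  exists g; rewrite /P gE eqxx andbT; apply/andP; split; first exact/mem_rhom.
  rewrite -res_exact; apply/subvP => _ /memv_imgP[x _ ->].
  rewrite memv_ker comp_lfunE -(comp_lfunE _ g) gE comp_lfunE.
  by rewrite res_diff_diff linear0.
exists f; split=> [k|x|k x].
- by have [/andP[/mem_rhom]] := fP k.
- by rewrite fE -comp_lfunE f0E.
- by have [_ /eqP/lfunP/(_ x)] := fP k; rewrite !comp_lfunE.
Qed.

Lemma chain_homotopy_exists R R' f g :
  @chain_map R R' f -> @chain_map R R' g ->
  exists h : forall k, 'Hom(res_obj R k, res_obj R' k.+1),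
  [/\ forall k, is_rhom (h k),
      forall x, f 0%N x - g 0%N x = res_diff R' 0 (h 0%N x)
    & forall k x, f k.+1 x - g k.+1 x =
        res_diff R' k.+1 (h k.+1 x) + h k (res_diff R k x)].
Proof.
move=> [fA f0 fS] [gA g0 gS].
have [|h0 h0A h0E] := proj_lift (@res_proj _ _ _ R 0%N)
  (@res_diff_hom _ _ _ R' 0%N) (sub_rhom (fA 0%N) (gA 0%N)).
  rewrite -res_exact0; apply/subvP => _ /memv_imgP[x _ ->].
  by rewrite memv_ker sub_lfunE linearB /= f0 g0 subrr.
(* The part of [f - g] in degree k+1 that [h] leaves over must lie in the image of the next
   differential; lifting it gives the next homotopy. *)
pose P k (h : 'Hom(res_obj R k, res_obj R' k.+1)) := (h \in rhom _ _) &&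
  (limg (f k.+1 - g k.+1 - (h \o res_diff R k))%VF
     <= limg (res_diff R' k.+1))%VS.
pose r k (h : 'Hom(res_obj R k, res_obj R' k.+1)) h' :=
  (res_diff R' k.+1 \o h' == f k.+1 - g k.+1 - (h \o res_diff R k))%VF.
have [||h [hE hP]] := @dependent_choice _ P r h0.
- apply/andP; split; first exact/mem_rhom.
  rewrite -res_exact; apply/subvP => _ /memv_imgP[x _ ->].
  rewrite memv_ker !sub_lfunE comp_lfunE !linearB /= fS gS.
  have /lfunP/(_ (res_diff R 0 x)) := h0E; rewrite comp_lfunE => ->.
  by rewrite sub_lfunE subrr.
- move=> k h /andP[/mem_rhom hA hd].
  have [||h' h'A h'E] := proj_lift (@res_proj _ _ _ R k.+1) _ _ hd.
  + exact: res_diff_hom.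
  + apply: sub_rhom; first exact: sub_rhom.
    by apply: comp_rhom => //; exact: res_diff_hom.
  exists h'; rewrite /r h'E eqxx andbT; apply/andP; split; first exact/mem_rhom.
  rewrite -res_exact; apply/subvP => _ /memv_imgP[x _ ->].
  rewrite memv_ker !sub_lfunE comp_lfunE !linearB /= fS gS.
  have /lfunP/(_ (res_diff R k.+1 x)) := h'E; rewrite comp_lfunE => ->.
  by rewrite !sub_lfunE comp_lfunE res_diff_diff linear0 subr0 subrr.
exists h; split=> [k|x|k x].
- by have [/andP[/mem_rhom]] := hP k.
- by have /lfunP/(_ x) := h0E; rewrite hE comp_lfunE sub_lfunE.
- have [_ /eqP/lfunP/(_ x)] := hP k; rewrite comp_lfunE => ->.
  by rewrite !sub_lfunE comp_lfunE subrK.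
Qed.

Lemma comp_chain_map R R' R'' f g : @chain_map R R' f -> @chain_map R' R'' g ->
  @chain_map R R'' (fun k => (g k \o f k)%VF).
Proof.
move=> [fA f0 fS] [gA g0 gS]; split=> [k|x|k x].
- exact: comp_rhom.
- by rewrite comp_lfunE g0 f0.
- by rewrite !comp_lfunE gS fS.
Qed.

Lemma id_chain_map R : @chain_map R R (fun k => \1%VF).
Proof. by split=> [k|x|k x]; rewrite ?id_lfunE //; exact: id_rhom. Qed.

(* A resolution R' of length k gives id ~ g f with f : R -> R' zero in degree
   k + 1; composing the homotopy identity with [res_diff R k] kills g f. *)
Lemma pd_le_split R k : pd_le M k ->
  exists2 h : 'Hom(res_obj R k, res_obj R k.+1), is_rhom h &
    forall x, res_diff R k (h (res_diff R k x)) = res_diff R k x.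
Proof.
case=> R' R'0; have [f fC] := chain_map_exists R R'.
have [g gC] := chain_map_exists R' R.
have [h [hA h0 hS]] :=
  chain_homotopy_exists (id_chain_map R) (comp_chain_map fC gC).
exists (h k) => // x; have [_ _ fS] := fC.
have fd0 : f k (res_diff R k x) = 0.
  have /eqP := R'0 k.+1 (ltnSn k); rewrite dimv_eq0 => /eqP z0.
  rewrite -fS; have := memvf (f k.+1 x); rewrite z0 memv0 => /eqP->.
  by rewrite linear0.
case: k {R'0} x fd0 => [|k] x; last first.
  move=> fd0; have := hS k (res_diff R k.+1 x).
  by rewrite id_lfunE comp_lfunE fd0 res_diff_diff !linear0 !addr0.
move=> fd0; have := h0 (res_diff R 0 x).
by rewrite id_lfunE comp_lfunE fd0 linear0 subr0.
Qed.

Lemma cocyclesP R N k z : reflect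
  (is_rhom z /\ forall x, z (res_diff R k x) = 0) (z \in cocycles R N k).
Proof.
rewrite memv_cap memv_ker precompE; apply: (iffP andP).
  move=> [/mem_rhom zA /eqP/lfunP zd]; split=> // x.
  by have := zd x; rewrite comp_lfunE zero_lfunE.
move=> [/mem_rhom zA zd]; split=> //; apply/eqP/lfunP => x.
by rewrite comp_lfunE zd zero_lfunE.
Qed.

Lemma coboundariesSP R N k (z : 'Hom(res_obj R k.+1, N)) : reflect
  (exists2 b : 'Hom(res_obj R k, N), is_rhom b &
     forall x, z x = b (res_diff R k x))
  (z \in coboundaries R N k.+1).
Proof.
apply: (iffP memv_imgP) => [[b /mem_rhom bA ->]|[b bA bE]].
  by exists b => // x; rewrite precompE comp_lfunE.
exists b; first exact/mem_rhom.
by apply/lfunP => x; rewrite precompE comp_lfunE.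
Qed.

End Comparison.

(** * Independence of the dimension of Ext from the resolution *)

Lemma subquotient_dim_le (F : fieldType) (V W : vectType F) (f : 'Hom(V, W))
    (Z B : {vspace V}) (Z' B' : {vspace W}) :
  (f @: Z <= Z')%VS -> (B' <= Z')%VS ->
  (forall z, z \in Z -> f z \in B' -> z \in B) ->
  (\dim Z - \dim B <= \dim Z' - \dim B')%N.
Proof.
(* [U] is the kernel of the map from [Z] to Z'/B' induced by [f]. It lies in [B], and Z/U embeds in
   Z'/B'. *)
move=> fZ BZ' ZB; pose U := (Z :&: (f @^-1: B'))%VS.
have UB : (\dim U <= \dim B)%N.
  apply/dimvS/subvP => z; rewrite memv_cap => /andP[zZ].
  by rewrite -memv_preim => /ZB; apply.
have kU : (U :&: lker f = Z :&: lker f)%VS.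
  apply/vspaceP => z; rewrite !memv_cap memv_ker -memv_preim -andbA.
  by congr andb; case: eqP => [->|]; rewrite ?mem0v ?andbF.
have fU : (f @: U = f @: Z :&: B')%VS.
  apply/vspaceP => y; rewrite memv_cap; apply/memv_imgP/andP.
    case=> z; rewrite memv_cap -memv_preim => /andP[zZ fz] ->.
    by rewrite memv_img.
  case=> /memv_imgP[z zZ ->] fz; exists z => //.
  by rewrite memv_cap zZ -memv_preim.
have dZ := limg_ker_dim f Z; have := limg_ker_dim f U; rewrite kU fU => dU.
have dC := dimv_sum_cap (f @: Z) B'.
have : (\dim (f @: Z + B') <= \dim Z')%N by rewrite dimvS // subv_add fZ.
by move: UB dZ dU dC; lia.
Qed.

Section ExtInvariance.
Variables (F : fieldType) (A : falgType F) (M N : rmodule A).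

(** Pullback along f : R' -> R is injective on cohomology, because f g is homotopic to the identity
    of [R]. Exchanging the resolutions gives equality. *)
Lemma ext_dim_le (R R' : proj_resolution M) k :
  (\dim (cocycles R N k) - \dim (coboundaries R N k)
     <= \dim (cocycles R' N k) - \dim (coboundaries R' N k))%N.
Proof.
have [f fC] := chain_map_exists R' R; have [g gC] := chain_map_exists R R'.
have [h [hA h0 hS]] :=
  chain_homotopy_exists (id_chain_map R) (comp_chain_map gC fC).
have [fA _ fS] := fC; have [gA _ gS] := gC.
apply: (@subquotient_dim_le _ _ _ (precomp N (f k))).
- apply/subvP => _ /memv_imgP[z /cocyclesP[zA zd] ->]; rewrite precompE.
  apply/cocyclesP; split=> [|x]; first exact: comp_rhom.
  by rewrite comp_lfunE -fS zd.
- exact: coboundaries_sub.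
move=> z /cocyclesP[zA zd]; rewrite precompE; case: k z zA zd => [|k] z zA zd.
  rewrite !memv0 => /eqP/lfunP zf; apply/eqP/lfunP => x; rewrite zero_lfunE.
  have := congr1 z (h0 x); rewrite zd linearB /= id_lfunE !comp_lfunE.
  by have := zf (g 0%N x); rewrite comp_lfunE zero_lfunE => ->; rewrite subr0.
case/coboundariesSP => b bA bE; apply/coboundariesSP.
(* Applying [z] to x - f g x = d h x + h d x, with z d = 0 and z f = b d', gives z = (z h + b g)
   d. *)
exists ((z \o h k) + (b \o g k))%VF.
  by apply/mem_rhom/rpredD; apply/mem_rhom/comp_rhom.
move=> x; rewrite add_lfunE !comp_lfunE -gS -bE comp_lfunE.
have := congr1 z (hS k x); rewrite linearB linearD /= zd id_lfunE comp_lfunE.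
by rewrite add0r => <-; rewrite subrK.
Qed.

Lemma ext_dimE (R : proj_resolution M) k d :
  ext_dim M N k d <-> (\dim (cocycles R N k) - \dim (coboundaries R N k))%N = d.
Proof.
split=> [[R' <-]|]; last by exists R.
by apply/eqP; rewrite eqn_leq !ext_dim_le.
Qed.

End ExtInvariance.

(** * Resolutions by principal right ideals *)

Section Principal.
Variables (F : fieldType) (A : falgType F).
Implicit Types (u a x y : A) (M N : rmodule A).

Lemma limg_amull u (U : {vspace A}) : (amull u @: U = <[u]> * U)%VS.
Proof.
apply/eqP; rewrite eqEsubv; apply/andP; split.
  by apply/subvP => _ /memv_imgP[y Uy ->]; rewrite lfunE /= memv_mul ?memv_line.
apply/prodvP => _ y /vlineP[c ->] Uy; rewrite -scalerAl memvZ //.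
by apply/memv_imgP; exists y; rewrite ?lfunE.
Qed.

Lemma amulrE u x : amulr u x = x * u.
Proof. by rewrite lfunE. Qed.

Lemma amullE u x : amull u x = u * x.
Proof. by rewrite lfunE. Qed.

Lemma rprincipalP u x : reflect (exists y, x = u * y) (x \in <[u]> * {:A})%VS.
Proof.
rewrite -limg_amull; apply: (iffP memv_imgP) => [[y _ ->]|[y ->]].
  by exists y; rewrite amullE.
by exists y; rewrite ?memvf ?amullE.
Qed.

Lemma lprincipalP u x : reflect (exists y, x = y * u) (x \in {:A} * <[u]>)%VS.
Proof.
apply: (iffP memv_cosetP) => [[y _ ->]|[y ->]]; first by exists y.
by exists y; rewrite ?memvf.
Qed.

Lemma rdim_eq0 x : (\dim (<[x]> * {:A})%VS == 0%N) = (x == 0).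
Proof.
rewrite dimv_eq0; apply/eqP/eqP => [E|->]; last by rewrite prod0v.
have : x \in (<[x]> * {:A})%VS by apply/rprincipalP; exists 1; rewrite mulr1.
by rewrite E memv0 => /eqP.
Qed.

Lemma ldim_eq0 x : (\dim ({:A} * <[x]>)%VS == 0%N) = (x == 0).
Proof.
rewrite dimv_eq0; apply/eqP/eqP => [E|->]; last by rewrite prodv0.
have : x \in ({:A} * <[x]>)%VS by apply/lprincipalP; exists 1; rewrite mul1r.
by rewrite E memv0 => /eqP.
Qed.

Lemma rprincipal_stable u (x : regular_rmodule A) a :
  x \in (<[u]> * {:A})%VS -> ract x a \in (<[u]> * {:A})%VS.
Proof.
move=> /rprincipalP[y ->]; apply/rprincipalP; exists (y * a).
by rewrite /= mulrA.
Qed.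

Definition principal u : rmodule A := sub_rmodule (@rprincipal_stable u).

(** A projection onto uA, defined for every [x]; it returns [x] itself when [x] lies in uA, as in
    [peltK]. *)
Definition pelt u x : principal u := vsproj (<[u]> * {:A})%VS x.

Lemma peltK u x y : x = u * y -> vsval (pelt u x) = x.
Proof. by move=> xE; rewrite vsprojK //; apply/rprincipalP; exists y. Qed.

Lemma pval_act u (x : principal u) a : vsval (ract x a) = vsval x * a.
Proof. exact: (subractE (@rprincipal_stable u)). Qed.

Definition orbit_map u M (m : M) : 'Hom(principal u, M) :=
  linfun (fun x : principal u => ract m (vsval x)).

Lemma orbit_mapE u M (m : M) (x : principal u) :
  orbit_map u m x = ract m (vsval x).
Proof.
by apply: (@linfunE F (principal u) M) => c y z; rewrite linearP ract_linearr.
Qed.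

Lemma orbit_map_rhom u M (m : M) : is_rhom (orbit_map u m).
Proof. by move=> x a; rewrite !orbit_mapE pval_act ractM. Qed.

Section Idempotent.
Variable u : A.
Hypothesis uu : u * u = u.

Definition pgen : principal u := pelt u u.

Lemma pgenK : vsval pgen = u.
Proof. by rewrite (@peltK _ _ 1) ?mulr1. Qed.

Lemma pval_idem (x : principal u) : u * vsval x = vsval x.
Proof. by have /rprincipalP[y ->] := subvsP x; rewrite mulrA uu. Qed.

Lemma pgen_act (x : principal u) : ract pgen (vsval x) = x.
Proof. by apply: subvs_inj; rewrite pval_act pgenK pval_idem. Qed.

(** Every homomorphism from uA is determined by its value at the generator, since x = u x for x in
    uA. *)
Lemma rhom_orbit M (f : 'Hom(principal u, M)) (x : principal u) :
  is_rhom f -> f x = ract (f pgen) (vsval x).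
Proof. by move=> fA; rewrite -fA pgen_act. Qed.

(** A preimage [m] of the image of the generator gives the lift sending x to m x. *)
Lemma principal_projective : is_projective (principal u).
Proof.
move=> M N g f gA fA gS; have : f pgen \in limg g by rewrite gS memvf.
case/memv_imgP => m _ mE; exists (orbit_map u m); first exact: orbit_map_rhom.
by apply/lfunP => x; rewrite comp_lfunE orbit_mapE gA -mE -rhom_orbit.
Qed.

End Idempotent.

Lemma projective_iso M N (g : 'Hom(M, N)) : is_rhom g -> limg g = fullv ->
  lker g = 0%VS -> is_projective M -> is_projective N.
Proof.
move=> gA gS /eqP g0 prM X Y p f pA fA pS.
have gK : cancel (g^-1)%VF g.
  by move=> y; apply: limg_lfunVK; rewrite gS memvf.
have gI : injective g by apply/lker0P.
have [|h hA hE] := prM X Y p (f \o g)%VF pA _ pS; first exact: comp_rhom.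
exists (h \o g^-1)%VF.
  apply: comp_rhom => // y a; apply: gI.
  by rewrite gA !gK.
by rewrite comp_lfunA hE; apply/lfunP => y; rewrite !comp_lfunE gK.
Qed.

End Principal.

(** * The resolution with terms u_k A and left multiplications by a_k as differentials *)

Section PrincipalResolution.
Variables (F : fieldType) (A : falgType F) (S : rmodule A) (s : S).
Variables u a : nat -> A.
Hypothesis uu : forall k, u k * u k = u k.
Hypothesis ua : forall k, u k * a k = a k.
Hypothesis au : forall k, a k * u k.+1 = a k.
Hypothesis su : ract s (u 0%N) = s.
Hypothesis s_gen : forall y, exists x, y = ract s x.
Hypothesis s_ann : forall x, ract s x = 0 <-> exists y, u 0%N * x = a 0%N * y.
Hypothesis a_ann :
  forall k x, a k * x = 0 <-> exists y, u k.+1 * x = a k.+1 * y.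

Let obj k := principal (u k).
Let diff k : 'Hom(obj k.+1, obj k) := orbit_map (u k.+1) (pelt (u k) (a k)).
Let aug : 'Hom(obj 0%N, S) := orbit_map (u 0%N) s.

Lemma pdiffE k x : vsval (diff k x) = a k * vsval x.
Proof. by rewrite orbit_mapE pval_act (@peltK _ _ _ _ (a k)) ?ua. Qed.

Lemma pdiff_gen k : diff k (pgen (u k.+1)) = pelt (u k) (a k).
Proof.
by apply: subvs_inj; rewrite pdiffE pgenK // au (@peltK _ _ _ _ (a k)) ?ua.
Qed.

Lemma mem_limg_pdiff k (x : obj k) :
  reflect (exists y, vsval x = a k * y) (x \in limg (diff k)).
Proof.
apply: (iffP memv_imgP) => [[y _ ->]|[y xE]].
  by exists (vsval y); rewrite pdiffE.
exists (pelt (u k.+1) (u k.+1 * y)); first exact: memvf.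
by apply: subvs_inj; rewrite pdiffE (@peltK _ _ _ _ y) // mulrA au.
Qed.

Fact paug_surj : limg aug = fullv.
Proof.
apply/eqP; rewrite eqEsubv subvf; apply/subvP => y _.
have [x ->] := s_gen y; apply/memv_imgP; exists (pelt (u 0%N) (u 0%N * x)).
  exact: memvf.
by rewrite orbit_mapE (@peltK _ _ _ _ x) // ractM su.
Qed.

Fact pexact0 : lker aug = limg (diff 0).
Proof.
apply/vspaceP => x; rewrite memv_ker orbit_mapE; apply/eqP/mem_limg_pdiff.
  by move/s_ann; rewrite pval_idem.
by move=> xE; apply/s_ann; rewrite pval_idem.
Qed.

Fact pexact k : lker (diff k) = limg (diff k.+1).
Proof.
apply/vspaceP => x.
rewrite memv_ker -(inj_eq (@subvs_inj _ _ _)) pdiffE linear0.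
apply/eqP/mem_limg_pdiff.
  by move/a_ann; rewrite pval_idem.
by move=> xE; apply/a_ann; rewrite pval_idem.
Qed.

Definition principal_resolution : proj_resolution S :=
  ProjResolution (fun k => principal_projective (uu k))
    (@orbit_map_rhom _ _ _ _ _) (fun k => @orbit_map_rhom _ _ _ _ _)
    paug_surj pexact0 pexact.

Local Notation R := principal_resolution.

Lemma principal_pd_le k : (forall j, (k < j)%N -> u j = 0) -> pd_le S k.
Proof.
move=> u0; exists R => j /u0 uj; apply/eqP; rewrite dimv_eq0 -subv0.
apply/subvP => x _; rewrite memv0; apply/eqP/subvs_inj.
by rewrite -(pval_idem (uu j)) [X in X * _]uj mul0r linear0.
Qed.

(** The splitting of [pd_le_split], evaluated at the generator of degree k+1. When [a k] lies in the
    radical, the identity forces [a k] to vanish. *)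
Lemma pd_le_principal k : pd_le S k -> exists h, a k = a k * h * a k.
Proof.
case/(pd_le_split R) => h hA hE; exists (vsval (h (pgen (u k)))).
have /(congr1 vsval) := hE (pgen (u k.+1)).
rewrite /= pdiff_gen [LHS]pdiffE (rhom_orbit (uu k) _ hA) pval_act.
by rewrite (@peltK _ _ _ _ (a k)) ?ua // mulrA => ->.
Qed.

(** Evaluation at the generator is injective on homomorphisms and identifies Hom(u_k A, A) with A
    u_k. Precomposition with the differential becomes right multiplication by [a k], so cocycles are
    a kernel in A u_k and coboundaries are A a_k. *)
Let ev k : 'Hom('Hom(res_obj R k, regular_rmodule A), A) :=
  linfun (fun f : 'Hom(res_obj R k, regular_rmodule A) => f (pgen (u k)) : A).

Let evE k f : ev k f = f (pgen (u k)).
Proof.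
by apply: (linfunE (f := fun f : 'Hom(res_obj R k, regular_rmodule A) =>
  f (pgen (u k)) : A)) => c x y; rewrite add_lfunE scale_lfunE.
Qed.

Let ev_dim k (U : {vspace 'Hom(res_obj R k, regular_rmodule A)}) :
  (forall f, f \in U -> is_rhom f) -> \dim (ev k @: U) = \dim U.
Proof.
move=> UA; apply: limg_dim_eq; apply/eqP; rewrite -subv0.
apply/subvP => f; rewrite memv_cap memv0 memv_ker evE => /andP[/UA fA /eqP f0].
apply/eqP/lfunP => x.
by rewrite (rhom_orbit (uu k) _ fA) f0 zero_lfunE /= mul0r.
Qed.

Lemma principal_cocycles_dim k :
  \dim (cocycles R (regular_rmodule A) k)
  = \dim (({:A} * <[u k]>) :&: lker (amulr (a k)))%VS.
Proof.
rewrite -[LHS]ev_dim => [|f /cocyclesP[]//]; congr (\dim _); apply/vspaceP => x.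
rewrite memv_cap memv_ker amulrE; apply/memv_imgP/andP.
  case=> f /cocyclesP[fA fd] ->; rewrite evE; split.
    apply/lprincipalP; exists (f (pgen (u k))).
    by rewrite [LHS](rhom_orbit (uu k) _ fA) pgenK.
  have := fd (pgen (u k.+1)); rewrite [res_diff R k _]pdiff_gen.
  by rewrite (rhom_orbit (uu k) _ fA) (@peltK _ _ _ _ (a k)) ?ua //= => ->.
case=> /lprincipalP[y xE] /eqP xa.
exists (orbit_map (u k) (x : regular_rmodule A)).
  apply/cocyclesP; split=> [|z]; first exact: orbit_map_rhom.
  by rewrite orbit_mapE [vsval _]pdiffE /= mulrA xa mul0r.
by rewrite evE orbit_mapE pgenK //= xE -mulrA uu.
Qed.

Lemma principal_coboundaries_dim k :
  \dim (coboundaries R (regular_rmodule A) k.+1) = \dim ({:A} * <[a k]>)%VS.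
Proof.
rewrite -[LHS]ev_dim => [|f]; last first.
  by case/coboundariesSP => b bA bE x c; rewrite !bE (@res_diff_hom _ _ _ R) bA.
congr (\dim _); apply/vspaceP => x; apply/memv_imgP/lprincipalP.
  case=> f /coboundariesSP[b bA bE] ->; exists (b (pgen (u k))).
  rewrite evE bE [res_diff R k _]pdiff_gen (rhom_orbit (uu k) _ bA).
  by rewrite (@peltK _ _ _ _ (a k)) ?ua.
case=> y ->; pose b := orbit_map (u k) (y : regular_rmodule A).
exists (b \o res_diff R k)%VF; last first.
  by rewrite evE comp_lfunE [res_diff R k _]pdiff_gen orbit_mapE
    (@peltK _ _ _ _ (a k)) ?ua.
apply/coboundariesSP; exists b; first exact: orbit_map_rhom.
by move=> z; rewrite comp_lfunE.
Qed.

Lemma ext0_dimE d : ext_dim S (regular_rmodule A) 0 d <->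
  \dim (({:A} * <[u 0%N]>) :&: lker (amulr (a 0%N)))%VS = d.
Proof. by rewrite (ext_dimE _ R) principal_cocycles_dim dimv0 subn0. Qed.

Lemma extS_dimE k d : ext_dim S (regular_rmodule A) k.+1 d <->
  (\dim (({:A} * <[u k.+1]>) :&: lker (amulr (a k.+1)))
    - \dim ({:A} * <[a k]>))%N%VS = d.
Proof.
by rewrite (ext_dimE _ R) principal_cocycles_dim principal_coboundaries_dim.
Qed.

End PrincipalResolution.

(** * Algebras spanned by the paths of a successor graph *)

Section SerialAlgebra.
Variables (F : fieldType) (A : falgType F) (V : finType) (nxt : V -> V).
Variables (e al : V -> A).

(** The class of the path of length [k] that starts at [v] and follows [nxt]; it may be zero. *)
Fixpoint walk (v : V) (k : nat) : A :=
  if k is k'.+1 then al v * walk (nxt v) k' else e v.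

Variable N : nat.
Hypothesis nxt_inj : injective nxt.
Hypothesis eM : forall v w, e v * e w = if v == w then e v else 0.
Hypothesis e_al : forall v, e v * al v = al v.
Hypothesis al_e : forall v, al v * e (nxt v) = al v.
(** Spanning is phrased through subspaces: a statement about all of [A] reduces to walks once it is
    written as membership in a subspace, often a preimage under [amull] or [amulr]. *)
Hypothesis walk_span :
  forall U : {vspace A}, (forall v k, walk v k \in U) -> forall x, x \in U.
Hypothesis walk_nil : forall v k, (N <= k)%N -> walk v k = 0.

Local Notation rdim x := (\dim (<[x]> * {:A})%VS).
Local Notation ldim x := (\dim ({:A} * <[x]>)%VS).

Lemma e_idem v : e v * e v = e v.
Proof. by rewrite eM eqxx. Qed.

Lemma e_walk v k : e v * walk v k = walk v k.
Proof. by case: k => [|k] /=; rewrite ?e_idem // mulrA e_al. Qed.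

Lemma walk1 v : walk v 1 = al v.
Proof. by rewrite /= al_e. Qed.

Lemma walkD v k l : walk v (k + l) = walk v k * walk (iter k nxt v) l.
Proof.
elim: k v => [|k IHk] v; first by rewrite /= e_walk.
by rewrite addSn /= IHk -iterSr mulrA.
Qed.

Lemma walk_e v k : walk v k * e (iter k nxt v) = walk v k.
Proof. by rewrite -[e _]/(walk _ 0) -walkD addn0. Qed.

Lemma walkSr v k : walk v k.+1 = walk v k * al (iter k nxt v).
Proof. by rewrite -addn1 walkD walk1. Qed.

Lemma walkM v k w l :
  walk v k * walk w l = if iter k nxt v == w then walk v (k + l) else 0.
Proof.
case: eqP => [<-|/eqP/negPf nvw]; first by rewrite walkD.
rewrite -(walk_e v k) -(e_walk w l) mulrA -(mulrA (walk v k)) eM nvw.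
by rewrite mulr0 mul0r.
Qed.

(** * The radical filtration and its nilpotency *)

Definition rad (s : nat) : {vspace A} := (\sum_v <[walk v s]> * {:A})%VS.

Lemma walk_rad v s x : walk v s * x \in rad s.
Proof.
apply: (subvP (@sumv_sup _ _ _ v xpredT _ _ _ (subvv _))) => //.
by rewrite memv_mul ?memv_line ?memvf.
Qed.

Lemma rad_sub s (U : {vspace A}) :
  (forall v x, walk v s * x \in U) -> (rad s <= U)%VS.
Proof.
move=> sU; apply/subv_sumP => v _; apply/subvP => _ /rprincipalP[x ->].
exact: sU.
Qed.

(** The right ideal [rad s] is two-sided: a walk followed by one of length [s] is zero or a longer
    walk, whose first [s] arrows again form a walk of length [s]. *)
Lemma rad_mull s a x : x \in rad s -> a * x \in rad s.
Proof.
move=> sx; rewrite -amullE memv_preim.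
apply: (subvP (rad_sub _)) sx => v y; rewrite -memv_preim amullE.
rewrite -amulrE memv_preim; apply: walk_span => w k.
rewrite -memv_preim amulrE mulrA walkM; case: eqP => _; last first.
  by rewrite mul0r mem0v.
by rewrite addnC walkD -mulrA walk_rad.
Qed.

Lemma rad_mulr s a x : x \in rad s -> x * a \in rad s.
Proof.
move=> sx; rewrite -amulrE memv_preim.
apply: (subvP (rad_sub _)) sx => v y; rewrite -memv_preim amulrE -mulrA.
exact: walk_rad.
Qed.

Lemma radM s x y : x \in rad 1 -> y \in rad s -> x * y \in rad s.+1.
Proof.
move=> rx sy; rewrite -amulrE memv_preim.
apply: (subvP (rad_sub _)) rx => v a; rewrite -memv_preim amulrE -mulrA.
rewrite -amullE memv_preim; apply: (subvP (rad_sub _)) (rad_mull a sy) => w b.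
rewrite -memv_preim amullE mulrA walkM; case: eqP => _; last first.
  by rewrite mul0r mem0v.
exact: walk_rad.
Qed.

Lemma rad_nilpotent x : x \in rad 1 -> x ^+ N.+1 = 0.
Proof.
move=> rx; have: x ^+ N.+1 \in rad N.+1.
  by elim: N => // k IHk; rewrite exprS radM.
have -> : rad N.+1 = 0%VS; last by rewrite memv0 => /eqP.
apply/eqP; rewrite -subv0; apply: rad_sub => v y.
by rewrite walk_nil // mul0r mem0v.
Qed.

(** Iteration gives x = z^k x for every k, and z is nilpotent. This and its mirror image play the
    role of Nakayama's lemma. *)
Lemma rad_fixl z x : z \in rad 1 -> x = z * x -> x = 0.
Proof.
move=> rz xE; have {}xE k : x = z ^+ k * x.
  by elim: k => [|k {1}->]; rewrite ?mul1r // exprSr -mulrA -xE.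
by rewrite (xE N.+1) rad_nilpotent ?mul0r.
Qed.

Lemma rad_fixr z x : z \in rad 1 -> x = x * z -> x = 0.
Proof.
move=> rz xE; have {}xE k : x = x * z ^+ k.
  by elim: k => [|k {1}->]; rewrite ?mulr1 // exprS mulrA -xE.
by rewrite (xE N.+1) rad_nilpotent ?mulr0.
Qed.

Lemma al_rad v : al v \in rad 1.
Proof. by rewrite -walk1 -[walk v 1]mulr1 walk_rad. Qed.

Lemma walk_radS v k : walk v k.+1 \in rad 1.
Proof. by rewrite /= rad_mulr ?al_rad. Qed.

Lemma e_decomp v x : exists c y, e v * x = c *: e v + al v * y.
Proof.
suff: x \in (amull (e v) @^-1: (<[e v]> + <[al v]> * {:A}))%VS.
  rewrite -memv_preim amullE => /memv_addP[_ /vlineP[c ->]].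
  by case=> _ /rprincipalP[y ->] ->; exists c, y.
apply: walk_span => w k; rewrite -memv_preim amullE -(e_walk w k) mulrA eM.
case: eqP => [<-|_]; last by rewrite mul0r mem0v.
rewrite e_walk; case: k => [|k].
  by apply: (subvP (addvSl _ _)); rewrite memv_line.
by apply: (subvP (addvSr _ _)); rewrite memv_mul ?memv_line ?memvf.
Qed.

(** Injectivity of [nxt] enters here: a nontrivial walk ending at [nxt v] has [al v] as its last
    arrow. *)
Lemma decomp_e v x : exists c y, x * e (nxt v) = c *: e (nxt v) + y * al v.
Proof.
suff: x \in (amulr (e (nxt v)) @^-1: (<[e (nxt v)]> + {:A} * <[al v]>))%VS.
  rewrite -memv_preim amulrE => /memv_addP[_ /vlineP[c ->]].
  by case=> _ /lprincipalP[y ->] ->; exists c, y.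
apply: walk_span => w k; rewrite -memv_preim amulrE -(walk_e w k) -mulrA eM.
case: eqP => [E|_]; last by rewrite mulr0 mem0v.
rewrite walk_e; case: k E => [|k] /= E.
  by apply: (subvP (addvSl _ _)); rewrite E memv_line.
apply: (subvP (addvSr _ _)); rewrite -[al w * _]/(walk w k.+1) walkSr.
by rewrite (nxt_inj E) memv_mul ?memv_line ?memvf.
Qed.

(** By [e_decomp], e_v A is the sum of the line of e_v and al_v A. It is direct: e_v = al_v y would
    make e_v a fixed point of a radical element. *)
Lemma rdim_e v : e v != 0 -> rdim (e v) = (rdim (al v)).+1.
Proof.
move=> en0; rewrite -(@dim_line_add _ _ (e v)); last first.
  apply: contra_neqN en0 => /rprincipalP[y eE].
  apply: (@rad_fixl (al v * y)); first exact/rad_mulr/al_rad.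
  by rewrite -eE e_idem.
congr (\dim _); apply/eqP; rewrite eqEsubv subv_add; apply/and3P; split.
- apply/subvP => _ /rprincipalP[x ->]; have [c [y ->]] := e_decomp v x.
  by rewrite memv_add ?memvZ ?memv_line // memv_mul ?memv_line ?memvf.
- by rewrite -memvE; apply/rprincipalP; exists 1; rewrite mulr1.
- apply/subvP => _ /rprincipalP[x ->]; apply/rprincipalP; exists (al v * x).
  by rewrite mulrA e_al.
Qed.

Lemma ldim_e v : e (nxt v) != 0 -> ldim (e (nxt v)) = (ldim (al v)).+1.
Proof.
move=> en0; rewrite -(@dim_line_add _ _ (e (nxt v))); last first.
  apply: contra_neqN en0 => /lprincipalP[y eE].
  apply: (@rad_fixl (y * al v)); first exact/rad_mull/al_rad.
  by rewrite -eE e_idem.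
congr (\dim _); apply/eqP; rewrite eqEsubv subv_add; apply/and3P; split.
- apply/subvP => _ /lprincipalP[x ->]; have [c [y ->]] := decomp_e v x.
  by rewrite memv_add ?memvZ ?memv_line // memv_mul ?memv_line ?memvf.
- by rewrite -memvE; apply/lprincipalP; exists 1; rewrite mul1r.
- apply/subvP => _ /lprincipalP[x ->]; apply/lprincipalP; exists (x * al v).
  by rewrite -mulrA al_e.
Qed.

(** By induction on j, e_v x is pushed into the right ideal of the walk of length j. The scalar
    coefficient of that walk must vanish, since the product of [p] with it is nonzero for j < l. *)
Lemma walk_annihilator w k l x :
  (forall j, (j < l)%N -> walk w k * walk (iter k nxt w) j != 0) ->
  walk w k * x = 0 ->
  exists y, e (iter k nxt w) * x = walk (iter k nxt w) l * y.
Proof.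
set p := walk w k; set v := iter k nxt w => pn0 px0.
suff: forall j, (j <= l)%N -> exists y, e v * x = walk v j * y by apply.
elim=> [_|j IHj jl]; first by exists x.
have [y xE] := IHj (ltnW jl); pose v' := iter j nxt v.
have [c [z yE]] := e_decomp v' y.
have {}xE : e v * x = c *: walk v j + walk v j.+1 * z.
  by rewrite xE -(walk_e v j) -mulrA yE mulrDr -scalerAr walk_e mulrA -walkSr.
have [c0|cn0] := eqVneq c 0; first by exists z; rewrite xE c0 scale0r add0r.
(* If [c] is nonzero, the relation p e_v x = 0 solves to p w_j = (p w_j) r, where w_j is the walk of
   length j from [v] and r is in the radical. *)
case/eqP: (pn0 j jl); apply: (@rad_fixr (al v' * (- c^-1 *: z))).
  exact/rad_mulr/al_rad.
have: p * (e v * x) = 0 by rewrite mulrA walk_e.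
rewrite xE mulrDr -scalerAr walkSr => /eqP; rewrite addr_eq0 => /eqP pE.
rewrite -!scalerAr scaleNr !mulrA -!(mulrA p) mulrA -scalerN -mulrA -pE.
by rewrite scalerA mulVf ?scale1r.
Qed.

(** * The minimal resolution of a simple module *)

(** The least length below [N] that annihilates; when there is none, [find] returns [N], where walks
    vanish anyway. *)
Definition walk_len (p : A) (v : V) : nat :=
  find (fun k => p * walk v k == 0) (iota 0 N).

Lemma walk_len_mul p v : p * walk v (walk_len p v) = 0.
Proof.
rewrite /walk_len; set Q := fun k => _.
have [hasQ|] := boolP (has Q (iota 0 N)).
  have := hasQ; rewrite has_find size_iota => lt.
  by have := nth_find 0%N hasQ; rewrite nth_iota // => /eqP.
by rewrite has_find size_iota -leqNgt => le; rewrite walk_nil ?mulr0.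
Qed.

Lemma walk_len_min p v j : (j < walk_len p v)%N -> p * walk v j != 0.
Proof.
move=> lt; have := before_find 0%N lt; rewrite nth_iota ?add0n => [->//|].
by apply: leq_trans lt _; rewrite -[leqRHS](size_iota 0) find_size.
Qed.

(* A state is a path together with its end; the next path generates the
   annihilator of the current one. *)
Definition next_state (s : A * V) : A * V :=
  if s.1 == 0 then s
  else (walk s.2 (walk_len s.1 s.2), iter (walk_len s.1 s.2) nxt s.2).

Variable i : V.

Definition state k : A * V := iter k next_state (al i, nxt i).
Definition syz k : A := (state k).1.
(** The idempotent of the k-th projective term, while [syz k] generates the image of the k-th
    differential. It is set to 0 after a vanishing path, so that the resolution stops. *)
Definition top k : A :=
  if k is k'.+1 then if syz k' == 0 then 0 else e (state k').2 else e i.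

Lemma syzS0 k : syz k = 0 -> syz k.+1 = 0.
Proof. by rewrite /syz /= /next_state => E; rewrite E eqxx. Qed.

Lemma syz_eq0_le k j : (k <= j)%N -> syz k = 0 -> syz j = 0.
Proof. by move=> /subnK<-; elim: (j - k)%N => // m IHm /IHm/syzS0. Qed.

Lemma stateS k : syz k != 0 ->
  state k.+1 = (walk (state k).2 (walk_len (syz k) (state k).2),
                iter (walk_len (syz k) (state k).2) nxt (state k).2).
Proof. by rewrite /syz /= /next_state => /negPf->. Qed.

Lemma state_walk k : syz k != 0 -> exists w l,
  syz k = walk w l.+1 /\ (state k).2 = iter l.+1 nxt w.
Proof.
elim: k => [|k IHk]; first by exists i, 0%N; rewrite walk1.
have [/syzS0->|n0 _] := eqVneq (syz k) 0; first by rewrite eqxx.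
have [w [l [E1 E2]]] := IHk n0; rewrite {1}/syz stateS //.
(* Length 0 is impossible: it would give p e = 0, whereas p e = p is nonzero. *)
exists (state k).2; case E: (walk_len _ _) => [|m]; last by exists m.
have := walk_len_mul (syz k) (state k).2; rewrite E /= E1 E2 walk_e.
by rewrite -E1 => /eqP; rewrite (negPf n0).
Qed.

Lemma syz_e k : syz k * e (state k).2 = syz k.
Proof.
have [->|/state_walk[w [l [-> ->]]]] := eqVneq (syz k) 0.
  by rewrite mul0r.
exact: walk_e.
Qed.

Lemma top_idem k : top k * top k = top k.
Proof. by case: k => [|k] /=; [|case: ifP => _]; rewrite ?e_idem ?mul0r. Qed.

Lemma top_syz k : top k * syz k = syz k.
Proof.
case: k => [|k] /=; first exact: e_al.
have [/syzS0->|n0] := eqVneq (syz k) 0; first by rewrite mul0r.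
by rewrite {1}/syz stateS // e_walk /syz stateS.
Qed.

Lemma syz_top k : syz k * top k.+1 = syz k.
Proof. by rewrite /=; case: eqP => [->|_]; rewrite ?mul0r ?syz_e. Qed.

Lemma syzM k : syz k * syz k.+1 = 0.
Proof.
have [->|n0] := eqVneq (syz k) 0; first by rewrite mul0r.
by rewrite {2}/syz stateS // walk_len_mul.
Qed.

Lemma syz_ann k x : syz k * x = 0 <-> exists y, top k.+1 * x = syz k.+1 * y.
Proof.
split=> [sx0|[y yE]]; last by rewrite -syz_top -mulrA yE mulrA syzM mul0r.
have [s0|n0] := eqVneq (syz k) 0.
  by exists 0; rewrite mulr0 /= s0 eqxx mul0r.
have [w [l [E1 E2]]] := state_walk n0.
rewrite {1}/syz stateS //= (negPf n0) E2.
apply: walk_annihilator; rewrite -E1 //.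
by move=> j; rewrite -E2; exact: walk_len_min.
Qed.

Lemma syz_rad k : syz k \in rad 1.
Proof.
have [->|/state_walk[w [l [-> _]]]] := eqVneq (syz k) 0; first exact: mem0v.
exact: walk_radS.
Qed.

(* Rank-nullity for left multiplication by [syz k] on [top k.+1 * A]. *)
Lemma rdim_top k : rdim (top k.+1) = (rdim (syz k.+1) + rdim (syz k))%N.
Proof.
rewrite -(limg_ker_dim (amull (syz k))); congr (_ + _)%N; congr (\dim _).
  apply/vspaceP => x; rewrite memv_cap memv_ker amullE; apply/andP/rprincipalP.
    case=> /rprincipalP[y ->]; rewrite mulrA syz_top => /eqP/syz_ann[z zE].
    by exists z.
  case=> y ->; split; last by rewrite mulrA syzM mul0r.
  by apply/rprincipalP; exists (syz k.+1 * y); rewrite mulrA top_syz.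
by rewrite limg_amull prodvA prodv_line syz_top.
Qed.

(** Rank-nullity for right multiplication by [syz k]; the kernel has the dimension of the k-cocycles
    with values in [A]. *)
Lemma ldim_top k :
  ldim (top k) = (\dim (({:A} * <[top k]>) :&: lker (amulr (syz k)))%VS
                  + ldim (syz k))%N.
Proof.
rewrite -(limg_ker_dim (amulr (syz k))); congr (_ + _)%N.
by rewrite limg_amulr -prodvA prodv_line top_syz.
Qed.

(** Coboundaries lie among cocycles, so a truncated difference of their dimensions equal to 0 means
    that the dimensions agree. *)
Lemma ldim_syz_le k :
  (ldim (syz k)
     <= \dim (({:A} * <[top k.+1]>) :&: lker (amulr (syz k.+1)))%VS)%N.
Proof.
apply/dimvS/subvP => _ /lprincipalP[x ->]; rewrite memv_cap memv_ker amulrE.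
rewrite -mulrA syzM mulr0 eqxx andbT; apply/lprincipalP; exists (x * syz k).
by rewrite -mulrA syz_top.
Qed.


(** * Projective dimension and regularity of the simple module at [i] *)

Section Simple.
Variable S : rmodule A.
Hypothesis dimS : \dim {:S} = 1%N.
Hypothesis S_e : forall x : S, ract x (e i) = x.
Hypothesis S_al : forall x : S, ract x (al i) = 0.

Let s : S := vpick {:S}.

Let s_neq0 : s != 0.
Proof. by rewrite vpick0 -dimv_eq0 dimS. Qed.

Lemma simple_gen (y : S) : exists x, y = ract s x.
Proof.
have : y \in <[s]>%VS.
  suff -> : <[s]>%VS = fullv by rewrite memvf.
  by apply/eqP; rewrite -dimv_leqif_eq ?subvf // dimS dim_vline s_neq0.
case/vlineP => c ->; exists (c *: 1).
by have := ract_linearr s c 1 0; rewrite ract0r !addr0 ract1 => ->.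
Qed.

Lemma simple_ann x : ract s x = 0 <-> exists y, top 0 * x = syz 0 * y.
Proof.
split=> [|[y yE]]; last by rewrite -(S_e s) -ractM yE ractM S_al ract0l.
have [c [y xE]] := e_decomp i x; rewrite -{1}(S_e s) -ractM xE ract_linearr.
rewrite ractM S_al ract0l addr0 S_e => /eqP.
rewrite scaler_eq0 (negPf s_neq0) orbF => /eqP c0.
by exists y; rewrite c0 scale0r add0r.
Qed.

(** The kernel of the map from e_i A to [S] is al_i A, so it is an isomorphism when al_i = 0. *)
Lemma al_eq0_projective : al i = 0 -> is_projective S.
Proof.
move=> al0; refine (projective_iso (@orbit_map_rhom _ _ (e i) _ s) _ _ _).
- apply/eqP; rewrite eqEsubv subvf; apply/subvP => y _.
  have [x ->] := simple_gen y; apply/memv_imgP; exists (pelt (e i) (e i * x)).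
    exact: memvf.
  by rewrite orbit_mapE (@peltK _ _ _ _ x) // ractM S_e.
- apply/eqP; rewrite -subv0; apply/subvP => x.
  rewrite memv_ker memv0 orbit_mapE => /eqP/simple_ann[y].
  rewrite /= pval_idem ?e_idem // [syz 0]al0 mul0r => E.
  by apply/eqP/subvs_inj; rewrite E linear0.
- exact/principal_projective/e_idem.
Qed.

(** If pd S <= k, then p = p h p for p = [syz k], and p h is in the radical, so p = 0. Conversely,
    all later idempotents [top] vanish. *)
Lemma simple_pd_le k : pd_le S k <-> syz k = 0.
Proof.
split=> [|sk0].
  case/(pd_le_principal top_idem top_syz syz_top (S_e s) simple_gen
    simple_ann syz_ann) => h E.
  by apply: (@rad_fixl (syz k * h)); rewrite // rad_mulr ?syz_rad.
apply: (principal_pd_le top_idem top_syz syz_top (S_e s) simple_gen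
    simple_ann syz_ann) => -[//|j] kj /=.
by rewrite (syz_eq0_le _ sk0) ?eqxx.
Qed.

Lemma simple_pd_eq k : pd_eq S k.+1 <-> syz k.+1 = 0 /\ syz k != 0.
Proof.
split=> [[/simple_pd_le s0 np]|[/simple_pd_le s0 np]]; split=> //.
  by apply/eqP => /simple_pd_le; exact: np.
move=> j jk /simple_pd_le sj; case/eqP: np.
exact: syz_eq0_le sj.
Qed.

Let ext0 d := ext0_dimE top_idem top_syz syz_top (S_e s) simple_gen
  simple_ann syz_ann d.
Let extS k d := extS_dimE top_idem top_syz syz_top (S_e s) simple_gen
  simple_ann syz_ann k d.

Hypothesis al_neq0 : al i != 0.

Let j := nxt i.
Let k := nxt j.

Let e_i_neq0 : e i != 0.
Proof. by apply: contraNneq al_neq0 => ei0; rewrite -e_al ei0 mul0r. Qed.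

Let e_j_neq0 : e j != 0.
Proof. by apply: contraNneq al_neq0 => ej0; rewrite -al_e -/j ej0 mulr0. Qed.

Let top1 : top 1 = e j.
Proof. by rewrite /= (negPf al_neq0). Qed.

Let cc_i : rdim (e i) = (rdim (al i)).+1.
Proof. exact: rdim_e. Qed.

Let dd_j : ldim (e j) = (ldim (al i)).+1.
Proof. exact: ldim_e. Qed.

Let cc_j : rdim (e j) = (rdim (syz 1) + rdim (al i))%N.
Proof. by rewrite -top1 rdim_top. Qed.

(** Ext^0 has dimension d_i - dim A al_i, and dim A al_i = d_{i+1} - 1. *)
Let ext0_eq0 :
  ext_dim S (regular_rmodule A) 0 0 <-> ldim (e j) = (ldim (e i)).+1.
Proof.
rewrite ext0 dd_j; have := ldim_top 0; rewrite -[top 0]/(e i) -[syz 0]/(al i).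
by move=> ->; lia.
Qed.

(** Since c_i - c_{i+1} = 1 - dim (syz 1) A, the first equation says pd S = 1; the second says Ext^0
    = 0. *)
Lemma simple_regular1 : regular 1 S <->
  rdim (e i) = (rdim (e j)).+1 /\ ldim (e j) = (ldim (e i)).+1.
Proof.
have syz1E : syz 1 = 0 <-> rdim (e i) = (rdim (e j)).+1.
  rewrite cc_i cc_j; split=> [->|E]; first by rewrite prod0v dimv0.
  by apply/eqP; rewrite -rdim_eq0; lia.
split=> [[/simple_pd_eq[s0 _] e0 _]|[/syz1E s0 /ext0_eq0 e0]].
  by split; [exact/syz1E|exact/ext0_eq0/e0].
split; first by apply/simple_pd_eq.
  by case.
(* With [syz 1] zero, Ext^1 is A e_j modulo A al_i, of dimension 1. *)
apply/extS; have := ldim_top 1; rewrite s0 top1 prodv0 dimv0 addn0 => <-.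
by rewrite dd_j subSn ?subnn.
Qed.

Let state1 : exists m, [/\ walk_len (al i) j = m.+1,
  syz 1 = walk j m.+1 & (state 1).2 = iter m.+1 nxt j].
Proof.
have E : state 1 = _ := stateS (k := 0) al_neq0.
case: (walk_len (al i) j) (walk_len_mul (al i) j) E => [/eqP|m _ E].
  by rewrite /= al_e (negPf al_neq0).
by exists m; rewrite /syz E.
Qed.

(* [A * syz 1] has codimension 1 in [A * top 2], as has [A * al w] for the last
   arrow [al w] of [syz 1]: the two agree, so [syz 1] is that arrow. *)
Lemma ext2_syz1 : syz 1 != 0 -> syz 2 = 0 ->
  ext_dim S (regular_rmodule A) 2 1 -> syz 1 = al j /\ top 2 = e k.
Proof.
have [m [_ s1E v1E]] := state1; move=> s1 s2 /extS.
have := ldim_top 2; rewrite s2 prodv0 dimv0 addn0 => <-.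
rewrite /= (negPf s1) v1E /=; set w := iter m nxt j.
have wE : syz 1 = walk j m * al w by rewrite s1E walkSr.
have ew : e (nxt w) != 0.
  by apply: contraNneq s1 => ew0; rewrite wE -al_e ew0 !mulr0.
rewrite (ldim_e ew) => dE.
have /eqP alE : ({:A} * <[syz 1]> == {:A} * <[al w]>)%VS.
  rewrite -dimv_leqif_eq; first by apply/eqP; lia.
  apply/subvP => _ /lprincipalP[x ->]; apply/lprincipalP.
  by exists (x * walk j m); rewrite wE mulrA.
case: m @w s1E wE {v1E ew dE} alE => [|m] w s1E wE alE.
  by rewrite s1E walk1.
have: al w \in ({:A} * <[al w]>)%VS.
  by apply/lprincipalP; exists 1; rewrite mul1r.
(* A walk of positive length before the last arrow gives al_w = z al_w with z in the radical, so
   [syz 1] would vanish. *)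
rewrite -alE => /lprincipalP[x]; rewrite wE mulrA => alwE.
case/eqP: s1; rewrite wE (rad_fixl _ alwE) ?mulr0 //.
exact/rad_mull/walk_radS.
Qed.

(** Forwards, [syz 1] is the arrow al_j: comparing the two formulas for c_j gives dim al_i A = 1,
    and Ext^1 = 0 gives dim A al_j = 1. Backwards, these two dimensions are read off c_i and d_k,
    and they force the same resolution. *)
Lemma simple_regular2 : regular 2 S <->
  [/\ rdim (e i) = 2%N, ldim (e k) = 2%N, rdim (e j) = (rdim (e k)).+1
    & ldim (e j) = (ldim (e i)).+1].
Proof.
have ext1_le := ldim_syz_le 0; have top1_l := ldim_top 1.
rewrite -[syz 0]/(al i) top1 in ext1_le top1_l.
split=> [[/simple_pd_eq[s2 s1] ext01 ext2]|[ci dk cj /ext0_eq0 e0]].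
  have /extS ext1 := ext01 1%N isT; rewrite -[syz 0]/(al i) top1 in ext1.
  have [s1E top2] := ext2_syz1 s1 s2 ext2.
  have := rdim_top 1; rewrite s2 prod0v dimv0 add0n top2 s1E => ck.
  have := rdim_e e_j_neq0; have := cc_j; rewrite s1E.
  have ek : e k != 0.
    by apply: contraNneq s1 => ek0; rewrite s1E -al_e -/k ek0 mulr0.
  have := ldim_e ek; rewrite -/k; have /ext0_eq0 := ext01 0%N isT.
  rewrite s1E in top1_l ext1_le ext1.
  by split; lia.
have ek : e k != 0 by rewrite -ldim_eq0 dk.
have dk' : ldim (e k) = (ldim (al j)).+1 := ldim_e ek.
have alj : al j != 0 by rewrite -ldim_eq0; lia.
(* As c_i = 2, al_i A is a line, so al_i al_j = c al_i; a nonzero c would make al_i a fixed point of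
   a radical element. *)
have al_ij : al i * al j = 0.
  have alE : <[al i]>%VS = (<[al i]> * {:A})%VS.
    apply/eqP; rewrite -dimv_leqif_eq.
      by rewrite dim_vline al_neq0; move: ci; rewrite cc_i => -[->].
    by rewrite -memvE; apply/rprincipalP; exists 1; rewrite mulr1.
  have : al i * al j \in <[al i]>%VS.
    by rewrite alE; apply/rprincipalP; exists (al j).
  case/vlineP => c E; have [c0|cn0] := eqVneq c 0.
    by rewrite E c0 scale0r.
  case/eqP: al_neq0; apply: (@rad_fixr (c^-1 *: al j)).
    exact/memvZ/al_rad.
  by rewrite -scalerAr E scalerA mulVf ?scale1r.
have [s1E v1E] : syz 1 = al j /\ (state 1).2 = k.
  have [m [lenE s1E v1E]] := state1.
  suff m0 : m = 0%N by rewrite s1E v1E m0 walk1.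
  apply/eqP; rewrite -leqn0 leqNgt; apply/negP => m_gt0.
  have := @walk_len_min (al i) j 1.
  by rewrite lenE walk1 al_ij eqxx => /(_ m_gt0).
have s1 : syz 1 != 0 by rewrite s1E.
have top2 : top 2 = e k by rewrite /= (negPf s1) v1E.
have := rdim_top 1; have := ldim_top 2; rewrite top2 s1E => top2_l top2_r.
have cj' := rdim_e e_j_neq0.
(* Here c_k = dim (syz 2) A + dim al_j A, while dim al_j A = c_j - 1 = c_k. *)
have s2 : syz 2 = 0 by apply/eqP; rewrite -rdim_eq0; lia.
rewrite s2 prodv0 dimv0 addn0 in top2_l.
split; first by apply/simple_pd_eq.
  case=> [//|[|//]] _; apply/extS; rewrite top1 -[syz 0]/(al i).
  by rewrite s1E in top1_l *; lia.
by apply/extS; rewrite top2 s1E s2 -top2_l; lia.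
Qed.

End Simple.
End SerialAlgebra.

(** * Nakayama algebras *)

Lemma path_eltM (F : fieldType) (Q : quiver) (p q : qpath Q) :
  path_elt F p * path_elt F q = path_mul_elt F p q.
Proof. exact: pathalg_mulUU. Qed.

Lemma path_elt_cons (F : fieldType) (Q : quiver) (p : qpath Q) (a : arrow Q) s :
  parrows p = a :: s ->
  exists q : qpath Q, [/\ pstart p = source a, pstart q = target a,
    parrows q = s & path_elt F p = path_elt F (arrow_path a) * path_elt F q].
Proof.
move=> pE; have := valP p; rewrite -[(val p).2]/(parrows p) pE.
case/andP=> /eqP sa ca; exists (@QPath Q (target a, s) ca); split=> //.
rewrite path_eltM /path_mul_elt.
have [//|r -> rE] := @path_compP _ (arrow_path a) (@QPath Q (target a, s) ca).
congr path_elt; apply: val_inj; rewrite rE [LHS]surjective_pairing.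
by congr (_, _).
Qed.

(** * Walks in the quotient algebra as images of quiver paths *)

Section Presentation.
Variables (F : fieldType) (t : nakayama_type) (n : nat) (A : falgType F).
Local Notation Q := (nakayama_quiver t n).
Variable pi : {rmorphism pathalg F Q -> A}.
Hypothesis pi_scalable : scalable pi.
Hypothesis pi_surj : forall a, exists x, pi x = a.
Variable m : nat.
Hypothesis pi_nil : forall x, ideal_exp (@arrow_ideal F Q) m x -> pi x = 0.

Definition has_arrow (v : 'I_n) : bool := is_cyclic t || (v.+1 < n)%N.

(* In the linear case [ordS] wraps around at the last vertex; this does no harm
   because [arrow_elt] vanishes there. *)
Definition arrow_elt (v : 'I_n) : A :=
  if insub v is Some a then pi (path_elt F (@arrow_path Q a)) else 0.

Lemma arrow_eltE (a : arrow Q) :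
  arrow_elt (val a) = pi (path_elt F (arrow_path a)).
Proof. by rewrite /arrow_elt valK. Qed.

Lemma arrow_eltP v : arrow_elt v = 0 \/ exists2 a : arrow Q,
  source a = v & arrow_elt v = pi (path_elt F (arrow_path a)).
Proof.
by rewrite /arrow_elt; case: insubP => [a _ <-|_]; [right; exists a|left].
Qed.

Lemma arrow_elt0 v : ~~ has_arrow v -> arrow_elt v = 0.
Proof. by move=> nv; rewrite /arrow_elt insubN. Qed.

Lemma idempM v w :
  idemp pi v * idemp pi w = if v == w then idemp pi v else 0.
Proof.
rewrite /idemp -rmorphM path_eltM /path_mul_elt path_comp1 /=.
by case: eqP => [->|_] //; exact: rmorph0.
Qed.

Lemma idemp_arrow v : idemp pi v * arrow_elt v = arrow_elt v.
Proof.
have [->|[a <- ->]] := arrow_eltP v; first by rewrite mulr0.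
by rewrite /idemp -rmorphM path_eltM /path_mul_elt path_comp1 eqxx.
Qed.

Lemma arrow_idemp v : arrow_elt v * idemp pi (ordS v) = arrow_elt v.
Proof.
have [->|[a <- ->]] := arrow_eltP v; first by rewrite mul0r.
by rewrite /idemp -rmorphM path_eltM /path_mul_elt path_comp1r eqxx.
Qed.

Local Notation walk := (walk (@ordS n) (idemp pi) arrow_elt).

Lemma pi_path (p : qpath Q) :
  pi (path_elt F p) = walk (pstart p) (size (parrows p)).
Proof.
move: {2}(parrows p) (erefl (parrows p)) => s.
elim: s p => [|a s IHs] p pE; rewrite pE.
  congr (pi (path_elt F _)); apply: val_inj.
  by rewrite [LHS]surjective_pairing; congr (_, _).
have [q [sp sq qE ->]] := path_elt_cons F pE.
by rewrite rmorphM (IHs q qE) qE sp sq /= arrow_eltE.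
Qed.

(** In the linear case, a walk that wraps around past the last vertex contains the zero [arrow_elt]
    there; a walk avoiding missing arrows comes from a genuine path. *)
Lemma walkP v k : walk v k = 0 \/ exists p : qpath Q,
  [/\ pstart p = v, size (parrows p) = k & walk v k = pi (path_elt F p)].
Proof.
elim: k v => [|k IHk] v; first by right; exists (@trivial_path Q v).
have [al0|[a sa _]] := arrow_eltP v; first by left; rewrite /= al0 mul0r.
have [w0|[q [sq qs _]]] := IHk (ordS v); first by left; rewrite /= w0 mulr0.
have epq : pend (arrow_path a) = pstart q by rewrite sq -sa.
have [p _ pE] := path_compP epq; right; exists p.
have [ps pk] : pstart p = v /\ size (parrows p) = k.+1.
  by rewrite /pstart /parrows pE /= qs; split.
by rewrite pi_path ps pk.
Qed.

Lemma walk_spanning (U : {vspace A}) :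
  (forall v k, walk v k \in U) -> forall x, x \in U.
Proof.
move=> wU x; have [y <-] := pi_surj x; rewrite [y]path_eltE rmorph_sum.
by apply: memv_suml => p _; rewrite pi_scalable memvZ // pi_path.
Qed.

Lemma path_elt_ideal (p : qpath Q) :
  ideal_exp (@arrow_ideal F Q) (size (parrows p)) (path_elt F p).
Proof.
move: {2}(parrows p) (erefl (parrows p)) => s.
elim: s p => [|a s IHs] p pE; rewrite pE //.
have [q [_ _ qE ->]] := path_elt_cons F pE.
move=> I _; apply; exists (path_elt F (arrow_path a)), (path_elt F q).
by split=> //; [move=> I' _; apply; exists a|rewrite -qE; exact: IHs].
Qed.

Lemma walk_nilpotent v k : (m <= k)%N -> walk v k = 0.
Proof.
move=> /subnKC <-; rewrite walkD; [|exact: idempM|exact: idemp_arrow].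
suff -> : walk v m = 0 by rewrite mul0r.
have [//|[p [_ pm ->]]] := walkP v m.
by apply: pi_nil; rewrite -pm; exact: path_elt_ideal.
Qed.

Lemma vertex_at_ord (v : 'I_n) : vertex_at t n v = Some v.
Proof.
rewrite /vertex_at modn_small ?ltn_ord // if_same.
exact: valK.
Qed.

(** Matches numerical indices with iterates of [ordS]; [None] at a missing arrow encodes the
    convention that the series vanish from index n on. *)
Lemma vertex_atS j v : vertex_at t n j = Some v ->
  vertex_at t n j.+1 = if has_arrow v then Some (ordS v) else None.
Proof.
rewrite /vertex_at /has_arrow; case: insubP => // w jn wE [<-] {v}.
case: (is_cyclic t) wE => /= wE.
  case: insubP => [x _ xE|]; last first.
    by rewrite ltn_mod; case: (n) w {jn wE} => [[]|].
  by congr Some; apply: val_inj; rewrite xE /= wE -addn1 -(modnDml j) addn1.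
rewrite wE; case: insubP => [x jSn xE|/negPf->//]; rewrite jSn; congr Some.
by apply: val_inj; rewrite xE /= wE modn_small.
Qed.

End Presentation.

Theorem theorem3p3 (F : fieldType) (t : nakayama_type) (n : nat)
    (hn : (1 <= n)%N) (I : pathalg F (nakayama_quiver t n) -> Prop)
    (hI : admissible I) (A : falgType F)
    (pi : {rmorphism pathalg F (nakayama_quiver t n) -> A})
    (hpi : is_quotient_map I pi) (i : 'I_n) (S : rmodule A)
    (hS : is_simple_at pi i S) (hnp : ~ is_projective S) :
  (regular 1 S <->
     (kupisch pi i)%:Z - (kupisch pi i.+1)%:Z = 1 /\
     (cokupisch pi i.+1)%:Z - (cokupisch pi i)%:Z = 1) /\
  (regular 2 S <->
     [/\ kupisch pi i = 2%N, cokupisch pi i.+2 = 2%N,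
         (kupisch pi i.+1)%:Z - (kupisch pi i.+2)%:Z = 1
       & (cokupisch pi i.+1)%:Z - (cokupisch pi i)%:Z = 1]).
Proof.
case: hpi => pi_scal pi_surj pi_ker; case: hI => _ [m _ [JI _]].
have pi_nil x :
    ideal_exp (@arrow_ideal F (nakayama_quiver t n)) m x -> pi x = 0.
  by move=> /JI/pi_ker.
case: hS => dimS S_idemp S_arrow.
have S_e (x : S) : ract x (idemp pi i) = x by rewrite S_idemp eqxx.
have S_al (x : S) : ract x (arrow_elt pi i) = 0.
  by have [->|[a _ ->]] := arrow_eltP pi i; rewrite ?ract0r.
have span := walk_spanning pi_scal pi_surj.
have nil := walk_nilpotent pi_nil.
(* Non-projectivity enters here; it also ensures that vertex i+1 exists. *)
have al_neq0 : arrow_elt pi i != 0.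
  apply/eqP => al0; apply: hnp.
  exact: (al_eq0_projective m (idempM pi) (idemp_arrow pi) span dimS S_e S_al
    al0).
have vi := vertex_at_ord t i.
have has_i : has_arrow t i by apply: contraNT al_neq0 => /arrow_elt0->.
have := vertex_atS vi; rewrite has_i => vj.
have reg1 := simple_regular1 (@ordS_inj n) (idempM pi) (idemp_arrow pi)
  (arrow_idemp pi) span nil dimS S_e S_al al_neq0.
have reg2 := simple_regular2 (@ordS_inj n) (idempM pi) (idemp_arrow pi)
  (arrow_idemp pi) span nil dimS S_e S_al al_neq0.
rewrite /kupisch /cokupisch vi vj (vertex_atS vj); split.
  by apply: (iff_trans reg1); split=> -[? ?]; split; lia.
have [has_j|/arrow_elt0 al0] := boolP (has_arrow t (ordS i)).
  by apply: (iff_trans reg2); split=> -[? ? ? ?]; split; lia.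
(* Now i+1 is the last vertex of the linear quiver. The value at i+2 is 0 by convention, so the
   right side fails; [reg2] instead sees the wrapped vertex, where al_j = 0 gives a left ideal of
   dimension 1, not 2. *)
apply: (iff_trans reg2); split=> -[// _ dk _ _].
have ek : idemp pi (ordS (ordS i)) != 0 by rewrite -ldim_eq0 dk.
have := ldim_e (@ordS_inj n) (idempM pi) (idemp_arrow pi) (arrow_idemp pi)
  span nil ek.
by rewrite al0 dk prodv0 dimv0.
Qed.
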